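(* There exist universal constants $C,C',C''>0$ such that the following holds. Let $\overline S\subset\mathcal L_0$ be a model which, viewed as a set of real-valued functions on $\overline{\mathcal X}$, is VC-subgraph with index $\overline V$. Then for all countable, identifiable and dense subsets $S$ of $\overline S$, $$\overline D(\overline S)\le c_2\overline D^S\le C\,\overline V\big[1+\log_+(n/\overline V)\big].$$ Consequently, any $\rho$-estimator $\widehat{\mathbf s}$ based on such an $S$ satisfies, whatever $\mathbf s\in\mathcal L_0$, $$\mathbb P_{\mathbf s}\Big[C'\mathbf h^2(\mathbf s,\widehat{\mathbf s})\le\mathbf h^2(\mathbf s,\overline S)+\overline V\big[1+\log_+(n/\overline V)\big]+\xi\Big]\ge1-e^{-\xi}\quad\text{for all }\xi>0$$ and $$C''\,\mathbb E_{\mathbf s}\big[\mathbf h^2(\mathbf s,\widehat{\mathbf s})\big]\le\mathbf h^2(\mathbf s,\overline S)+\overline V\big[1+\log_+(n/\overline V)\big].$$ If $\mathcal X_i=\mathcal X$ for all $i$ and $\overline S$ is of the form $\{\mathbf t=(t,\dots,t),\,t\in\Theta\}$ for a set $\Theta$ of real-valued functions on $\mathcal X$ which is VC-subgraph with index $\overline V$, the previous bound still holds.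
   Context: Setting. Let $n\ge3$. For $1\le i\le n$, $(\mathcal X_i,\mathcal A_i,\mu_i)$ is a measured space and $\mathcal L_i$ is the set of probability densities with respect to $\mu_i$; $\mathcal L_0=\prod_{i=1}^n\mathcal L_i$, with elements $\mathbf t=(t_1,\dots,t_n)$. $\boldsymbol X=(X_1,\dots,X_n)$ is a vector of independent random variables, $X_i$ having values in $\mathcal X_i$ and density $s_i$ with respect to $\mu_i$; $\mathbf s=(s_1,\dots,s_n)$, and $\mathbb P_{\mathbf s},\mathbb E_{\mathbf s}$ denote probability and expectation for this distribution. For densities $u,v\in\mathcal L_i$, $h^2(u,v)=\frac12\int(\sqrt u-\sqrt v)^2d\mu_i$ and $\rho(u,v)=\int\sqrt{uv}\,d\mu_i$; for $\mathbf t,\mathbf t'\in\mathcal L_0$, $\mathbf h^2(\mathbf t,\mathbf t')=\sum_{i=1}^nh^2(t_i,t_i')$ and $\mathbf h(\mathbf t,S)=\inf_{\mathbf u\in S}\mathbf h(\mathbf t,\mathbf u)$. $S\subset\mathcal L_0$ is identifiable if $\mathbf h(\mathbf u,\mathbf u')>0$ for all distinct $\mathbf u,\mathbf u'\in S$. A model is a nonempty separable subset of the pseudometric space $(\mathcal L_0,\mathbf h)$; density is with respect to $\mathbf h$. ''Countable'' means finite or countable. Conventions: $0/0=1$, $x/0=+\infty$ for $x>0$, $0\times(+\infty)=0$, $\sup\varnothing=0$, $\log_+x=\max\{\log x,0\}$. Constants: $c_0=\frac18(1-\frac1{\sqrt2})$, $c_1=2(7+4\sqrt2)$, $c_2=1+\frac1{\sqrt2}$,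 $\kappa=357$. An element $\mathbf t\in\mathcal L_0$ is viewed as a function on $\overline{\mathcal X}=\bigcup_{i=1}^n(\{i\}\times\mathcal X_i)$ by $\mathbf t(i,x)=t_i(x)$. A class $\mathcal F$ of functions from a set $\Xi$ to $(-\infty,+\infty]$ is VC-subgraph with index $\overline V$ if the class of subgraphs $\{(x,u)\in\Xi\times\mathbb R: f(x)>u\}$, $f\in\mathcal F$, is a VC-class with finite VC-index $\overline V$, i.e. $\overline V$ is the smallest integer $m$ such that no set of $m$ points is shattered by the class (VC-dimension plus one). $\rho$-estimators. Let $\psi(u)=\frac{u-1}{\sqrt{1+u^2}}$ for $u\in[0,+\infty)$ and $\psi(+\infty)=1$. For $\mathbf t,\mathbf t'\in\mathcal L_0$ and $\mathbf r=(\mathbf t+\mathbf t')/2$, $\mathbf T(\boldsymbol X,\mathbf t,\mathbf t')=\frac12\sum_{i=1}^n[\rho(t_i',r_i)-\rho(t_i,r_i)]+\frac1{\sqrt2}\sum_{i=1}^n\psi\big(\sqrt{t_i'/t_i}(X_i)\big)$. For a countable identifiable $S\subset\mathcal L_0$, $\boldsymbol\Upsilon(S,\mathbf t)=\sup_{\mathbf t'\in S}\mathbf T(\boldsymbol X,\mathbf t,\mathbf t')$ and $\mathcal E(\boldsymbol X,S)=\{\widetilde{\mathbf s}\in S:\boldsymbol\Upsilon(S,\widetilde{\mathbf s})\le\inf_{\mathbf t\in S}\boldsymbol\Upsilon(S,\mathbf t)+\kappa/10\}$. A $\rho$-estimator based on $S$ is any element $\widehat{\mathbf s}=\widehat{\mathbf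 s}(\boldsymbol X)$, chosen in a measurable way, of $\mathrm{Cl}(\mathcal E(\boldsymbol X,S))=\{\mathbf t\in\mathcal L_0:\mathbf h(\mathbf t,\mathcal E(\boldsymbol X,S))=0\}$. Dimensions. $\mathbf Z(\boldsymbol X,\mathbf t,\mathbf t')=\sum_{i=1}^n\{\psi(\sqrt{t_i'/t_i}(X_i))-\mathbb E_{\mathbf s}[\psi(\sqrt{t_i'/t_i}(X_i))]\}$. For countable $S\subset\mathcal L_0$, $\overline{\mathbf s}\in\mathcal L_0$, $y\geq 0$: $\mathcal B^S(\mathbf s,\overline{\mathbf s},y)=\{\mathbf t\in S:\mathbf h^2(\mathbf s,\mathbf t)+\mathbf h^2(\mathbf s,\overline{\mathbf s})\le y^2\}$, $\mathbf w^S(\mathbf s,\overline{\mathbf s},y)=\mathbb E_{\mathbf s}[\sup_{\mathbf t\in\mathcal B^S(\mathbf s,\overline{\mathbf s},y)}|\mathbf Z(\boldsymbol X,\overline{\mathbf s},\mathbf t)|]$ (equal to $0$ if the set is empty), $D^S(\mathbf s,\overline{\mathbf s})=\overline y^2\vee1$ with $\overline y=\sup\{y\ge0:\mathbf w^S(\mathbf s,\overline{\mathbf s},y)>c_0y^2\}$, and $\overline D^S=\sup_{(\mathbf s,\overline{\mathbf s})\in\mathcal L_0\times\mathcal L_0}D^S(\mathbf s,\overline{\mathbf s})$. The uniform dimension of a model is $\overline D(\overline S)=\inf_S[2c_1\sup_{\mathbf u\in\overline S}\mathbf h^2(\mathbf u,S)+c_2\overline D^S]$, the infimum being over all countable identifiable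 $S\subset\mathcal L_0$. *)

(* Defs.v *)
From HB Require Import structures.
From mathcomp Require Import all_boot all_order all_algebra.
From mathcomp Require Import all_classical all_reals all_analysis.

Set Implicit Arguments.
Unset Strict Implicit.
Unset Printing Implicit Defensive.

Import Order.TTheory GRing.Theory Num.Theory.
Import numFieldNormedType.Exports.

Local Open Scope classical_set_scope.
Local Open Scope ring_scope.

Section constants.
Context {R : realType}.

Definition c0 : R := 8^-1 * (1 - (Num.sqrt 2)^-1).
Definition c1 : R := 2 * (7 + 4 * Num.sqrt 2).
Definition c2 : R := 1 + (Num.sqrt 2)^-1.
Definition kappa : R := 357.

(* [ln] is 0 on nonpositive reals, so this is also 0 there. *)
Definition logp (x : R) : R := Num.max (ln x) 0.

Definition vc_rate (n V : nat) : R := V%:R * (1 + logp (n%:R / V%:R)).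

(* Supremum of a set of nonnegative extended reals, with sup set0 = 0
   (whereas [ereal_sup set0 = -oo]). *)
Definition sup0 (A : set (\bar R)) : \bar R :=
  if A == set0 then 0%E else ereal_sup A.

(* The quotient a / b of nonnegative reals, with 0 / 0 = 1 and
   a / 0 = +oo for a > 0. *)
Definition quot (a b : R) : \bar R :=
  if b == 0 then (if a == 0 then 1%E else +oo%E) else (a / b)%:E.

(* Only used on [0, +oo]; the value at -oo is irrelevant. *)
Definition psi (u : \bar R) : R :=
  match u with
  | r%:E%E => (r - 1) / Num.sqrt (1 + r ^+ 2)
  | +oo%E => 1
  | -oo%E => -1
  end.

End constants.

Section vc.

Definition shattered (T : Type) (C : set (set T)) (A : set T) :=
  forall B, B `<=` A -> exists2 c, C c & A `&` c = B.

(* V is the smallest m such that no set of m points is shattered by C, that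
   is, the VC-dimension plus one. *)
Definition vc_index (T : Type) (C : set (set T)) (V : nat) :=
  (forall A : set T, (A #= `I_V)%card -> ~ shattered C A) /\
  (forall m : nat, (m < V)%N ->
     exists A : set T, (A #= `I_m)%card /\ shattered C A).

Definition subgraph (R : realType) (Xi : Type) (f : Xi -> R) : set (Xi * R) :=
  [set p | p.2 < f p.1].

Definition vc_subgraph (R : realType) (Xi : Type) (F : set (Xi -> R))
    (V : nat) :=
  vc_index [set subgraph f | f in F] V.

End vc.

Section densities.
Context {R : realType} {n : nat} {d : 'I_n -> measure_display}.
Context {X : forall i : 'I_n, measurableType (d i)}.
Variable mu : forall i : 'I_n, {measure set (X i) -> \bar R}.

Definition density (i : 'I_n) : set (X i -> R) :=
  [set t : X i -> R | [/\ measurable_fun [set: X i] t, (forall x : X i, 0 <= t x) &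
     (\int[mu i]_x (t x)%:E = 1)%E]].

Definition L0 : set (forall i, X i -> R) :=
  [set t | forall i, density (t i)].

Definition hell2 (i : 'I_n) (u v : X i -> R) : R :=
  2^-1 * \int[mu i]_x ((Num.sqrt (u x) - Num.sqrt (v x)) ^+ 2).

Definition affinity (i : 'I_n) (u v : X i -> R) : R :=
  \int[mu i]_x Num.sqrt (u x * v x).

Definition h2 (t t' : forall i, X i -> R) : R :=
  \sum_(i < n) hell2 (t i) (t' i).

Definition h (t t' : forall i, X i -> R) : R := Num.sqrt (h2 t t').

(* Equal to +oo when S is empty. *)
Definition hset (t : forall i, X i -> R) (S : set (forall i, X i -> R)) :
    \bar R :=
  ereal_inf [set (h t u)%:E | u in S].

Definition hclosure (S : set (forall i, X i -> R)) :
    set (forall i, X i -> R) :=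
  [set t | L0 t /\ hset t S = 0%E].

Definition dense_in (S Sbar : set (forall i, X i -> R)) :=
  S `<=` Sbar /\ Sbar `<=` hclosure S.

Definition identifiable (S : set (forall i, X i -> R)) :=
  forall u u', S u -> S u' -> u <> u' -> 0 < h u u'.

Definition model (Sbar : set (forall i, X i -> R)) :=
  [/\ Sbar `<=` L0, Sbar !=set0 &
      exists D, countable D /\ dense_in D Sbar].

(* t viewed as a function on the disjoint union of the X i. *)
Definition joint_fun (t : forall i, X i -> R) : {i : 'I_n & X i} -> R :=
  fun p => t (projT1 p) (projT2 p).

Definition vc_model (Sbar : set (forall i, X i -> R)) (V : nat) :=
  vc_subgraph [set joint_fun t | t in Sbar] V.

Definition cast (A B : Type) (e : A = B) (x : A) : B :=
  let: erefl in _ = Y := e return Y in x.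

(* All the sets X i are equal to one set T (their sigma-algebras and measures
   may differ) and Sbar = {(t, .., t), t in Theta}, Theta being VC-subgraph
   on T. *)
Definition diagonal_vc_model (Sbar : set (forall i, X i -> R)) (V : nat) :=
  exists (T : Type) (eX : forall i, (X i : Type) = T) (Theta : set (T -> R)),
    Sbar = [set (fun i x => t (cast (eX i) x)) | t in Theta] /\
    vc_subgraph Theta V.

Definition Tstat (x : forall i, X i) (t t' : forall i, X i -> R) : R :=
  let r i y := (t i y + t' i y) / 2 in
  2^-1 * \sum_(i < n) (affinity (t' i) (r i) - affinity (t i) (r i))
  + (Num.sqrt 2)^-1 *
    \sum_(i < n) psi (sqrte (quot (t' i (x i)) (t i (x i)))).

(* If S is nonempty this is a supremum over a nonempty set, and if S is empty
   it is never evaluated at an element of S. *)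
Definition Upsilon (x : forall i, X i) (S : set (forall i, X i -> R))
    (t : forall i, X i -> R) : \bar R :=
  ereal_sup [set (Tstat x t t')%:E | t' in S].

Definition Eset (x : forall i, X i) (S : set (forall i, X i -> R)) :
    set (forall i, X i -> R) :=
  [set t | S t /\
    (Upsilon x S t <=
     ereal_inf [set Upsilon x S t' | t' in S] + (kappa / 10)%:E)%E].

End densities.

Section experiment.
Context {R : realType} {n : nat} {d : 'I_n -> measure_display}.
Context {X : forall i : 'I_n, measurableType (d i)}.
Variable mu : forall i : 'I_n, {measure set (X i) -> \bar R}.
Context {dO : measure_display} {Om : measurableType dO}.
Variable Xv : forall i : 'I_n, {mfun Om >-> X i}.

Definition independent (Q : probability Om R) :=
  forall (J : {set 'I_n}) (A : forall i, set (X i)),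
    (forall i, measurable (A i)) ->
    Q (\bigcap_(i in [set i | i \in J]) (Xv i @^-1` A i)) =
    (\prod_(i in J) Q (Xv i @^-1` A i))%E.

Definition has_density (Q : probability Om R) (i : 'I_n) (t : X i -> R) :=
  forall A : set (X i), measurable A ->
    Q (Xv i @^-1` A) = (\int[mu i]_(x in A) (t x)%:E)%E.

Definition sample (w : Om) : forall i, X i := fun i => Xv i w.

(* P s is the probability on Om under which the coordinates of the sample are
   independent with respective densities s i, for each s in L0. *)
Definition experiment (P : (forall i, X i -> R) -> probability Om R) :=
  forall s, L0 mu s ->
    independent (P s) /\ (forall i, has_density (P s) (s i)).

(* The choice is measurable in the sense that it is measurable for the
   sigma-algebra generated by the balls of (L0, h). *)
Definition rho_estimator (S : set (forall i, X i -> R))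
    (shat : (forall i, X i) -> (forall i, X i -> R)) :=
  (forall w : Om, hclosure mu (Eset mu (sample w) S) (shat (sample w))) /\
  (forall t, L0 mu t ->
     measurable_fun setT (fun w : Om => h mu t (shat (sample w)))).

Variable P : (forall i, X i -> R) -> probability Om R.

Definition Zstat (s : forall i, X i -> R) (t t' : forall i, X i -> R)
    (w : Om) : R :=
  let f i (v : Om) := psi (sqrte (quot (t' i (Xv i v)) (t i (Xv i v)))) in
  \sum_(i < n) (f i w - \int[P s]_v f i v).

Definition Bset (S : set (forall i, X i -> R)) (s sbar : forall i, X i -> R)
    (y : R) : set (forall i, X i -> R) :=
  [set t | S t /\ h2 mu s t + h2 mu s sbar <= y ^+ 2].

Definition wS (S : set (forall i, X i -> R)) (s sbar : forall i, X i -> R)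
    (y : R) : \bar R :=
  (\int[P s]_v sup0 [set `|Zstat s sbar t v|%:E | t in Bset S s sbar y])%E.

Definition ybar (S : set (forall i, X i -> R)) (s sbar : forall i, X i -> R) :
    \bar R :=
  sup0 [set y%:E | y in
    [set y : R | 0 <= y /\ ((c0 * y ^+ 2)%:E < wS S s sbar y)%E]].

Definition DS (S : set (forall i, X i -> R)) (s sbar : forall i, X i -> R) :
    \bar R :=
  maxe (ybar S s sbar ^+ 2)%E 1%E.

Definition Dbar (S : set (forall i, X i -> R)) : \bar R :=
  sup0 [set z | exists s sbar,
    [/\ L0 mu s, L0 mu sbar & z = DS S s sbar]].

Definition uniform_dim (Sbar : set (forall i, X i -> R)) : \bar R :=
  ereal_inf
    [set ((2 * c1)%:E * sup0 [set (hset mu u S ^+ 2)%E | u in Sbar]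
          + c2%:E * Dbar S)%E |
      S in [set S | [/\ S `<=` L0 mu, countable S & identifiable mu S]]].

End experiment.

(* Main.v *)
(* Write Z for the centred empirical process. Instead of Talagrand's inequality,
   an exponential moment of sup_t (|Z(t)| - 2c sum_i E f_t(X_i)^2) is bounded
   directly, with f_t = psi(sqrt(t / sbar)). By Jensen's inequality a ghost
   sample X' replaces the means by f_t(X'_i) and f_t(X'_i)^2, independent swaps
   of X_i and X'_i do not change the law, and, averaged over the swaps, each t
   contributes at most 1. On the 2n points of the two samples the class is
   V / n-close to finitely many functions, at most exp(O(V (1 + log+(n / V)))) of
   them, by the Sauer-Shelah lemma applied to the subgraphs at the levels l / L,
   with L about n / V.
   As E f_t^2 is at most a multiple of h^2(s, t) + h^2(s, sbar), a small c makes
   the offset smaller than (c0 / 2) (h^2(s, t) + h^2(s, sbar)). This bounds the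
   dimension and, since T(X, sbar, t) has mean at most
   c2 h^2(s, sbar) - 8 c0 h^2(s, t) and is antisymmetric, also the risk of the
   rho-estimators. *)
Require Import Defs.
From HB Require Import structures.
From mathcomp Require Import all_boot all_order all_algebra.
From mathcomp Require Import all_classical all_reals all_analysis.
From mathcomp Require Import measurable_realfun ring lra.

Set Implicit Arguments.
Unset Strict Implicit.
Unset Printing Implicit Defensive.

Import Order.TTheory GRing.Theory Num.Theory.
Import numFieldNormedType.Exports.

Local Open Scope classical_set_scope.
Local Open Scope ring_scope.

(** * Sauer-Shelah lemma and VC-subgraph classes *)

Section sauer.
Local Open Scope set_scope.

(** The rate dictates the size of the net: n summands, each moved by at most V / n, cost O(V) in
    total. The net depends on both samples. This is harmless, because only its size enters and
    because exchanging X_i with X'_i leaves the set of 2n points unchanged, so that one net serves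
    all 2^n swaps. The quadratic offset replaces a decomposition of S into shells where h^2(s, t) is
    of order y^2: the supremum over the whole of S has a controlled exponential moment, and a ball
    of radius y enters only by bounding the offset by (c0 / 2) y^2, half of the threshold that
    defines the dimension. The offset contains the square at the ghost point only; this suffices
    because both orders of each pair are averaged, which cancels the linear terms. The single
    exponential moment has two uses: 1 + x <= exp x yields expectations, Markov's inequality yields
    tails. Leftover additive constants (infima and closures approximated to within 1, the tolerance
    kappa / 10) are absorbed because V >= 1. *)

Definition traces_on (T : finType) (F : {set {set T}}) (A : {set T}) :=
  [forall B in powerset A, exists C in F, C :&: A == B].

(* Pajor's inequality: split F according to a point x that separates two of its
   members. A set traced by both halves is traced by F together with x. *)
Lemma card_traces_on (T : finType) (F : {set {set T}}) :
  (#|F| <= #|[set A | traces_on F A]|)%N.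
Proof.
elim: {F}#|F| {-2}F (leqnn #|F|) => [|k IH] F leFk.
  by move: leFk; rewrite leqn0 => /eqP ->.
have traces_sub (G : {set {set T}}) (A : {set T}) :
    G \subset F -> traces_on G A -> traces_on F A.
  move=> /fintype.subsetP GF /forall_inP tG; apply/forall_inP => B BA.
  have /exists_inP[C GC CB] := tG B BA.
  by apply/exists_inP; exists C => //; exact: GF.
case: (boolP [exists x, (F :&: [set C : {set T} | x \in C] != finset.set0) &&
                        (F :\: [set C : {set T} | x \in C] != finset.set0)]); last first.
  rewrite negb_exists => /forallP Fx.
  have F1 C D : C \in F -> D \in F -> C = D.
    move=> FC FD; apply/setP => x; have := Fx x; rewrite negb_and !negbK.
    case/orP => /eqP/setP Fx0.
      by have := Fx0 C; have := Fx0 D; rewrite !inE FC FD /= => -> ->.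
    by have := Fx0 C; have := Fx0 D; rewrite !inE FC FD /= !andbT
      => /negbFE -> /negbFE ->.
  have [->|[C FC]] := set_0Vmem F; first by rewrite cards0.
  have -> : F = [set C].
    by apply/setP => D; rewrite !inE; apply/idP/eqP => [FD|->//]; exact: F1.
  rewrite cards1 card_gt0; apply/finset.set0Pn; exists finset.set0; rewrite inE.
  apply/forall_inP => B; rewrite powersetE finset.subset0 => /eqP ->.
  by apply/exists_inP; exists C; rewrite ?inE // finset.setI0.
move=> /existsP[x /andP[]].
set F1 := F :&: _; set F0 := F :\: _ => F10 F00.
have cF : (#|F1| + #|F0|)%N = #|F| by rewrite cardsID.
move: F10 F00; rewrite -!card_gt0 => F10 F00.
have {}IH1 : (#|F1| <= #|[set A | traces_on F1 A]|)%N.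
  by apply: IH; rewrite -ltnS (leq_trans _ leFk) // -cF -addn1 leq_add2l.
have {}IH0 : (#|F0| <= #|[set A | traces_on F0 A]|)%N.
  by apply: IH; rewrite -ltnS (leq_trans _ leFk) // -cF -add1n leq_add2r.
set S1 := [set A | traces_on F1 A] in IH1 *.
set S0 := [set A | traces_on F0 A] in IH0 *.
have xS1 A : A \in S1 -> x \notin A.
  rewrite inE => /forall_inP tA; apply/negP => xA.
  have /tA/exists_inP[C] : A :\ x \in powerset A by rewrite powersetE finset.subD1set.
  by rewrite !inE => /andP[_ xC] /eqP/setP/(_ x); rewrite !inE xC xA eqxx.
have xS0 A : A \in S0 -> x \notin A.
  rewrite inE => /forall_inP tA; apply/negP => xA.
  have /tA/exists_inP[C] : A \in powerset A by rewrite powersetE.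
  by rewrite !inE => /andP[/negbTE xC _] /eqP/setP/(_ x); rewrite !inE xC xA.
pose S2 := [set x |: A | A in S1 :&: S0].
have cS2 : #|S2| = #|S1 :&: S0|.
  apply: card_in_imset => A B; rewrite !inE => /andP[A1 _] /andP[B1 _].
  have xA : x \notin A by apply: xS1; rewrite inE.
  have xB : x \notin B by apply: xS1; rewrite inE.
  by move=> /(congr1 (fun C => C :\ x)); rewrite !finset.setU1K.
rewrite -cF; apply: (leq_trans (leq_add IH1 IH0)).
rewrite -cardsUI -cS2 -cardsUI.
have -> : (S1 :|: S0) :&: S2 = finset.set0.
  apply/setP => A; rewrite [RHS]inE; apply/negP; rewrite inE => /andP[].
  rewrite finset.in_setU => /orP AS /imsetP[B _] eA.
  have : x \notin A by case: AS => [/xS1|/xS0].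
  by rewrite eA setU11.
rewrite cards0 addn0; apply: subset_leq_card; apply/fintype.subsetP => A.
rewrite !finset.in_setU => /orP[/orP[]|].
- by rewrite !inE; apply: traces_sub; exact: finset.subsetIl.
- by rewrite !inE; apply: traces_sub; exact: finset.subsetDl.
case/imsetP => B; rewrite finset.in_setI => /andP[B1 B0] ->.
have xB := xS1 _ B1.
move: B1 B0; rewrite !inE => /forall_inP B1 /forall_inP B0.
apply/forall_inP => D; rewrite powersetE => DxB.
have DB : D :\ x \in powerset B by rewrite powersetE subDset.
have [xD|xD] := boolP (x \in D).
  have /exists_inP[C] := B1 _ DB; rewrite !inE => /andP[FC xC] /eqP eC.
  apply/exists_inP; exists C => //; rewrite finset.setIUr eC.
  by rewrite (finset.setIidPr _) ?finset.sub1set // finset.setD1K.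
have /exists_inP[C] := B0 _ DB; rewrite !inE => /andP[xC FC] /eqP eC.
apply/exists_inP; exists C => //; rewrite finset.setIUr eC.
have -> : C :&: [set x] = finset.set0.
  by apply/setP => y; rewrite !inE; case: eqP => [->|]; rewrite ?(negbTE xC) ?andbF.
rewrite finset.set0U; apply/eqP/setP => y; rewrite !inE.
by case: eqP => // ->; rewrite (negbTE xD).
Qed.

(** Every traced set, that is every set shattered by [F], has fewer than [V] points, and Pajor's
    inequality bounds [#|F|] by the number of such sets. Each of them contributes x^|A| >= x^V to
    the expansion of (1 + x)^|T| over all subsets. The free [x] avoids sums of binomial
    coefficients. *)
Lemma sauer (R : realType) (T : finType) (F : {set {set T}}) (V : nat) (x : R) :
  0 < x -> x <= 1 ->
  (forall A : {set T}, #|A| = V -> ~~ traces_on F A) ->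
  #|F|%:R <= x ^- V * (1 + x) ^+ #|T|.
Proof.
move=> x0 x1 noV.
have small (A : {set T}) : traces_on F A -> (#|A| < V)%N.
  rewrite ltnNge => tA; apply/negP => VA.
  have [B BA cB] : exists2 B : {set T}, B \subset A & #|B| = V.
    have /card_geqP[s [us ss sA]] := VA.
    exists [set y in s]; last by rewrite cardsE (card_uniqP us).
    by apply/fintype.subsetP => y; rewrite inE; exact: sA.
  have /negP := noV B cB; apply; apply/forall_inP => D; rewrite powersetE => DB.
  have /forall_inP/(_ D) := tA.
  rewrite powersetE (fintype.subset_trans DB BA) => /(_ isT)/exists_inP[C FC /eqP eC].
  apply/exists_inP; exists C => //; apply/eqP/setP => y.
  have := congr1 (fun E => y \in E :&: B) eC; rewrite !inE -andbA.
  have [yB|] := boolP (y \in B); first by rewrite (fintype.subsetP BA _ yB) !andbT.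
  by move=> yB _; rewrite andbF; apply/esym/negbTE; apply: contra yB; exact: fintype.subsetP.
have -> : (1 + x) ^+ #|T| = \sum_(A : {set T}) x ^+ #|A|.
  rewrite -prodr_const.
  rewrite (eq_bigr (fun=> x + 1)) => [|i _]; last by rewrite addrC.
  rewrite bigA_distr; apply: eq_bigr => A _.
  rewrite -big_mkcond /=; by rewrite prodr_const.
rewrite ler_pdivlMl ?exprn_gt0 //.
apply: (@le_trans _ _ (\sum_(A : {set T} | traces_on F A) x ^+ #|A|)); last first.
  rewrite big_mkcond; apply: ler_sum => A _.
  by case: ifP => // _; rewrite exprn_ge0 // ltW.
apply: (@le_trans _ _ (\sum_(A : {set T} | traces_on F A) x ^+ V)).
  rewrite big_const iter_addr_0 -[leRHS]mulr_natr ler_wpM2l ?exprn_ge0 ?(ltW x0) //.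
  by rewrite ler_nat -[X in (_ <= X)%N]cardsE; exact: card_traces_on.
by apply: ler_sum => A tA; apply: ler_wiXn2l; rewrite ?(ltW x0) // ltnW // small.
Qed.

End sauer.

(** An upward closed [Q] may be a closed half-line, whereas subgraphs involve a strict inequality;
    on finitely many values the two can be made to agree. *)
Lemma up_closed_threshold (R : realType) (s : seq R) (Q : R -> bool) :
  (forall u v, u <= v -> Q u -> Q v) ->
  exists u, forall v, v \in s -> (u < v) = Q v.
Proof.
(* The induction carries an alternative. If [Q] fails at [u], then [u] is already below every value
   where [Q] holds; if [Q] holds on the whole list, [u] may be lowered at will. *)
move=> upQ; suff [u [us _]] : exists u,
    (forall v, v \in s -> (u < v) = Q v) /\ (~~ Q u \/ forall v, v \in s -> Q v).
  by exists u.
elim: s => [|a s [u [us]]]; first by exists 0; split=> //; right.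
have gtQ b v : ~~ Q b -> Q v -> b < v.
  by move=> Qb Qv; rewrite ltNge; apply: contra Qb => /upQ; exact.
case=> [Qu|sQ].
  exists (if Q a then u else Num.max u a); split.
    move=> v; rewrite inE => /orP[/eqP ->|vs]; case: ifP => Qa.
    - by rewrite gtQ.
    - by rewrite gt_max ltxx andbF.
    - exact: us.
    - rewrite gt_max us //; case Qv: (Q v) => //=.
      by rewrite gtQ ?Qa.
  by left; case: ifP => // Qa; rewrite /Num.max; case: ifP => // _; rewrite Qa.
case Qa: (Q a).
  exists (Num.min u (a - 1)); split.
    move=> v; rewrite inE => /orP[/eqP ->|vs].
      by rewrite gt_min ltrBlDr ltrDl ltr01 orbT.
    by rewrite sQ // gt_min us // sQ.
  by right=> v; rewrite inE => /orP[/eqP ->|/sQ].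
exists a; split; last by left; rewrite Qa.
by move=> v; rewrite inE => /orP[/eqP ->|/sQ Qv]; rewrite ?ltxx ?Qa // Qv gtQ ?Qa.
Qed.

Lemma set_enum_card (T : finType) (A : {set T}) : ([set` A] #= `I_#|A|)%card.
Proof.
have eI : `I_#|A| = [set nat_of_ord i | i in [set: 'I_#|A|]].
  apply/seteqP; split=> [i iA|_ [i _ <-]]; last exact: ltn_ord.
  by exists (Ordinal iA).
have eA : [set` A] = [set enum_val i | i in [set: 'I_#|A|]].
  apply/seteqP; split=> [x xA|_ [i _ <-]]; last exact: enum_valP.
  by exists (enum_rank_in xA x) => //; exact: enum_rankK_in.
rewrite eI eA card_eq_sym.
apply: card_eq_trans (inj_card_eq (in2W (@ord_inj _))) _.
by rewrite card_eq_sym; exact: inj_card_eq (in2W enum_val_inj).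
Qed.

(* Upward closed conditions on g (p j) become subgraph conditions once finitely
   many functions, one per trace, have been selected. *)
Lemma vc_subgraph_trace (R : realType) (Xi : Type) (G : set (Xi -> R)) (V : nat)
    (g : nat -> Xi -> R) (J : finType) (p : J -> Xi) (Q : J -> R -> bool) :
  vc_subgraph G V -> (forall k, G (g k)) ->
  (forall j u v, u <= v -> Q j u -> Q j v) ->
  exists r : seq nat,
    (forall x : R, 0 < x -> x <= 1 ->
       (size r)%:R <= x ^- V * (1 + x) ^+ #|J|) /\
    forall k, exists2 k', k' \in r & forall j, Q j (g k (p j)) = Q j (g k' (p j)).
Proof.
move=> [noV _] Gg upQ.
pose tr k : {set J} := [set j | Q j (g k (p j))]%SET.
pose F : {set {set J}} := [set A | `[<exists k, tr k = A>]]%SET.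
have /choice[rep repP] : forall A : {set J}, exists k, A \in F -> tr k = A.
  move=> A; have [AF|] := boolP (A \in F); last by exists 0.
  by move: (AF); rewrite inE => /asboolP[k] ?; exists k.
exists [seq rep A | A <- enum F]; split; last first.
  move=> k; exists (rep (tr k)).
    by apply: map_f; rewrite mem_enum inE; apply/asboolP; exists k.
  have := repP (tr k); rewrite inE => -/(_ _)/wrap[|/finset.setP e j].
    by apply/asboolP; exists k.
  by have := e j; rewrite !inE.
move=> x x0 x1; rewrite size_map -cardE; apply: sauer => // A cA.
apply/negP => /forall_inP tA.
(* A threshold has to be right only for the representatives, which form a finite list. The points (p
   j, u j) are the ones to be shattered. *)
have /choice[u uP] : forall j, exists u,
    forall v, v \in [seq g (rep B) (p j) | B <- enum F] -> (u < v) = Q j v.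
  by move=> j; apply: up_closed_threshold; exact: upQ.
pose q j := (p j, u j).
have qE B j : B \in F -> subgraph (g (rep B)) (q j) <-> j \in B.
  move=> BF; rewrite /subgraph /= uP; last by apply: map_f; rewrite mem_enum.
  by rewrite -[in j \in B](repP B BF) inE.
(* Some trace meets [A] exactly in {i}; it would contain [j] as well if the points of [i] and [j]
   coincided. Hence the image of [A] still has [V] points. *)
have qinj : {in A &, injective q}.
  move=> i j iA jA qij.
  have /tA/exists_inP[C CF /eqP CA] : [set i]%SET \in powerset A.
    by rewrite powersetE finset.sub1set.
  have : i \in C by move/finset.setP/(_ i): CA; rewrite !inE eqxx => /andP[].
  move/(qE _ _ CF); rewrite qij => /(qE _ _ CF) jC.
  by move/finset.setP/(_ j): CA; rewrite !inE jC jA => /esym/eqP.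
apply: (noV (q @` [set` A])).
  rewrite -cA; apply: card_eq_trans (set_enum_card A); apply: inj_card_eq => i j.
  by rewrite !inE; exact: qinj.
move=> B BA; pose D := [set j in A | `[<B (q j)>]]%SET.
have /tA/exists_inP[C CF /eqP CA] : D \in powerset A.
  by rewrite powersetE; apply/fintype.subsetP => j; rewrite !inE => /andP[].
exists (subgraph (g (rep C))); first by exists (g (rep C)).
have CD j : j \in A -> (j \in C) = `[<B (q j)>].
  by move=> jA; move/finset.setP/(_ j): CA; rewrite !inE jA andbT.
apply/seteqP; split=> [_ [[j /= jA <-]] /(qE _ _ CF)|y By].
  by rewrite CD // => /asboolP.
have [j /= jA qj] := BA _ By; split; first by exists j.
by rewrite -qj; apply/(qE _ _ CF); rewrite CD //; apply/asboolP; rewrite qj.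
Qed.

(* A single discretisation level is enough (no chaining): its cost is a factor
   log (n / V), which the rate allows. *)
Lemma vc_subgraph_cover (R : realType) (Xi : Type) (G : set (Xi -> R)) (V : nat)
    (g : nat -> Xi -> R) (J : finType) (p : J -> Xi) (phi : J -> R -> R)
    (L : nat) :
  (0 < L)%N -> vc_subgraph G V -> (forall k, G (g k)) ->
  (forall j u v, u <= v -> phi j u <= phi j v) ->
  (forall j u, `|phi j u| <= 1) ->
  exists r : seq nat,
    (forall x : R, 0 < x -> x <= 1 ->
       (size r)%:R <= x ^- V * (1 + x) ^+ (#|J| * (2 * L))) /\
    forall k, exists2 k', k' \in r &
      forall j, `|phi j (g k (p j)) - phi j (g k' (p j))| <= L%:R^-1.
Proof.
move=> L0 vcG Gg mono bnd.
have LR : 0 < L%:R :> R by rewrite ltr0n.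
(* The 2L levels l / L - 1 cut [-1, 1) into steps of length 1 / L. *)
pose Q (jl : J * 'I_(2 * L)) (u : R) := jl.2%:R / L%:R - 1 < phi jl.1 u.
have [|r [sr rP]] := @vc_subgraph_trace R Xi G V g _ (p \o fst) Q vcG Gg.
  by move=> jl u v uv /lt_le_trans; apply; exact: mono.
exists r; split=> [x x0 x1|k].
  by have := sr x x0 x1; rewrite card_prod card_ord.
have [k' k'r kk'] := rP k; exists k' => // j.
have main (a b : R) : (forall l : 'I_(2 * L),
    (l%:R / L%:R - 1 < a) = (l%:R / L%:R - 1 < b)) ->
    -1 <= a -> b <= 1 -> b - a <= L%:R^-1.
  move=> ab a1 b1; rewrite leNgt; apply/negP => ltab.
  have y0 : 0 <= (a + 1) * L%:R by rewrite mulr_ge0 // ?ler0n// -lerBlDr sub0r.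
  (* The first level above [a]. If b - a > 1 / L it lies below [b], so it tells [a] and [b]
     apart. *)
  pose l := (Num.truncn ((a + 1) * L%:R)).+1.
  have /andP[l1 l2] := Num.Theory.truncn_itv y0.
  have al : a <= l%:R / L%:R - 1 by rewrite lerBrDr ler_pdivlMr // ltW.
  have lb : l%:R / L%:R - 1 < b.
    rewrite -ltrBrDr opprK ltr_pdivrMr //.
    rewrite /l -natr1; apply: (@le_lt_trans _ _ ((a + 1) * L%:R + 1)).
      by rewrite lerD2r.
    rewrite -[X in _ + X < _](mulVf (lt0r_neq0 LR)) -mulrDl ltr_pM2r //; lra.
  have lL : (l < 2 * L)%N.
    rewrite -(ltr_nat R) natrM -ltr_pdivrMr //; lra.
  by have := ab (Ordinal lL); rewrite /= lb ltNge al.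
rewrite ler_norml lerNl opprB; apply/andP; split; apply: main.
- by move=> l; exact: (kk' (j, l)).
- by have := bnd j (g k (p j)); rewrite ler_norml => /andP[].
- by have := bnd j (g k' (p j)); rewrite ler_norml => /andP[].
- by move=> l; apply/esym; exact: (kk' (j, l)).
- by have := bnd j (g k' (p j)); rewrite ler_norml => /andP[].
- by have := bnd j (g k (p j)); rewrite ler_norml => /andP[].
Qed.

Lemma logp_ge0 (R : realType) (x : R) : 0 <= logp x.
Proof. by rewrite /logp le_max lexx orbT. Qed.

Lemma vc_rate_ge (R : realType) (n V : nat) : V%:R <= vc_rate n V :> R.
Proof.
by rewrite /vc_rate mulrDr mulr1 lerDl mulr_ge0 ?ler0n // logp_ge0.
Qed.

Lemma cover_size_le (R : realType) (n V : nat) (N : R) :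
  (0 < n)%N -> (0 < V)%N ->
  (forall x : R, 0 < x -> x <= 1 ->
     N <= x ^- V * (1 + x) ^+ ((n * 2) * (2 * (n %/ V).+1))) ->
  N <= expR (8 * vc_rate n V).
Proof.
move=> n0 V0 hN.
have nR : 0 < n%:R :> R by rewrite ltr0n.
have VR : 0 < V%:R :> R by rewrite ltr0n.
(* This is min(1, V / n)^2. Then x^-V = exp(2 V log+(n / V)); for V <= n the exponent m is at most 8
   n^2 / V, so m x <= 8 V, and for V > n already m = 4 n <= 4 V. *)
pose x : R := expR (- (2 * logp (n%:R / V%:R))).
have x0 : 0 < x by exact: expR_gt0.
have x1 : x <= 1 by rewrite -expR0 ler_expR oppr_le0 mulr_ge0 // logp_ge0.
apply: le_trans (hN x x0 x1) _.
have xV : x ^- V = expR (2 * V%:R * logp (n%:R / V%:R)).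
  rewrite /x -expRM_natl -expRN; congr expR; ring.
set m := ((n * 2) * (2 * (n %/ V).+1))%N.
have xm : (1 + x) ^+ m <= expR (m%:R * x).
  rewrite expRM_natl; apply: lerXn2r; rewrite ?nnegrE ?expR_ge0 ?expR_ge1Dx //.
  by rewrite addr_ge0 // ltW.
suff mx : m%:R * x <= 8 * V%:R.
  apply: (@le_trans _ _ (x ^- V * expR (m%:R * x))).
    by rewrite ler_wpM2l // invr_ge0 exprn_ge0 // ltW.
  rewrite xV -expRD ler_expR /vc_rate.
  have : 0 <= V%:R * logp (n%:R / V%:R) :> R by rewrite mulr_ge0 ?ler0n // logp_ge0.
  set l := logp _; nra.
have [Vn|nV] := leqP V n; last first.
  rewrite /m divn_small // !natrM.
  have nVR : n%:R <= V%:R :> R by rewrite ler_nat ltnW.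
  nra.
have ln0 : 0 <= ln (n%:R / V%:R : R).
  by apply: ln_ge0; rewrite ler_pdivlMr // mul1r ler_nat.
have xE : x = (V%:R / n%:R) ^+ 2.
  rewrite /x /logp max_l //.
  rewrite -mulrN expRM_natl -lnV ?posrE ?divr_gt0 // invf_div.
  by rewrite lnK // posrE divr_gt0.
have L2 : (n %/ V).+1%:R <= 2 * n%:R / V%:R :> R.
  rewrite ler_pdivlMr // -natrM -natrM ler_nat mul2n -addnn mulSn.
  by rewrite leq_add // leq_divM.
rewrite xE /m !natrM.
apply: (@le_trans _ _ (n%:R * 2 * (2 * (2 * n%:R / V%:R)) * (V%:R / n%:R) ^+ 2)).
  rewrite ler_wpM2r ?sqr_ge0 // ler_wpM2l ?mulr_ge0 ?ler0n //.
  by rewrite ler_wpM2l ?ler0n.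
rewrite le_eqVlt; apply/orP; left; apply/eqP; field.
by rewrite !lt0r_neq0.
Qed.

(** * Change of density *)

Section change_of_density.
Context d (T : measurableType d) (R : realType).
Variables (mu nu : {measure set T -> \bar R}) (s : T -> R).
Hypotheses (s0 : forall x, 0 <= s x) (ms : measurable_fun setT s).
Hypothesis nuE : forall A, measurable A -> nu A = (\int[mu]_(x in A) (s x)%:E)%E.
Import HBNNSimple.
Local Open Scope ereal_scope.

(* The library's change of variables for Radon-Nikodym derivatives requires mu
   to be sigma-finite. *)
Lemma ge0_integral_density (f : T -> R) :
  (forall x, 0 <= f x)%R -> measurable_fun setT f ->
  \int[nu]_x (f x)%:E = \int[mu]_x (f x * s x)%:E.
Proof.
move=> f0 mf.
have mfE : measurable_fun setT (EFin \o f) by exact/measurable_EFinP.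
pose h := nnsfun_approx measurableT mfE.
have -> : \int[nu]_x (f x)%:E =
    lim (\int[nu]_x (EFin \o h n) x @[n --> \oo]).
  have fE x : (f x)%:E = lim ((EFin \o h n) x @[n --> \oo]).
    apply/esym/cvg_lim => //; apply: (cvg_nnsfun_approx measurableT mfE) => //.
    by move=> y _; rewrite /= lee_fin.
  under eq_integral => x _ do rewrite fE.
  apply: monotone_convergence => //.
  - by move=> n; apply/measurable_EFinP; exact/measurable_funP.
  - by move=> n x _ //=; rewrite lee_fin.
  - by move=> x _ a b ab; rewrite lee_fin; exact/lefP/nd_nnsfun_approx.
have -> : \int[mu]_x (f x * s x)%:E =
    lim (\int[mu]_x ((h n x)%:E * (s x)%:E) @[n --> \oo]).
  have fg x : (f x * s x)%:E = lim ((h n x)%:E * (s x)%:E @[n --> \oo]).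
    apply/esym/cvg_lim => //; rewrite EFinM; apply: cvgeZr => //.
    apply: (cvg_nnsfun_approx measurableT mfE) => //.
    by move=> y _; rewrite /= lee_fin.
  under eq_integral => x _ do rewrite fg.
  apply: monotone_convergence => [//| | |].
  - by move=> n; apply: emeasurable_funM; exact/measurable_EFinP.
  - by move=> n x _ /=; rewrite mule_ge0 ?lee_fin.
  - by move=> x _ a b ab/=; rewrite lee_wpmul2r ?lee_fin ?s0//; exact/lefP/nd_nnsfun_approx.
suff suf n : \int[nu]_x (EFin \o h n) x = \int[mu]_x ((h n x)%:E * (s x)%:E).
  by under eq_fun do rewrite suf.
transitivity (\int[nu]_x (\sum_(y \in range (h n)) (y * \1_(h n @^-1` [set y]) x)%:E)).
  by apply: eq_integral => t tE; rewrite /= fimfunE -fsumEFin.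
have indich m r : measurable_fun setT (fun x => (r * \1_(h m @^-1` [set r]) x)%:E).
  by apply: (measurable_comp measurableT) => //; exact: measurable_funM.
rewrite ge0_integral_fsum//; last by move=> m y Ey; exact: nnfun_muleindic_ge0.
transitivity (\int[mu]_x (\sum_(y \in range (h n))
    (y * \1_(h n @^-1` [set y]) x)%:E * (s x)%:E)); last first.
  apply: eq_integral => x xE.
  rewrite -ge0_mule_fsuml => [|y]; last exact: nnfun_muleindic_ge0.
  by rewrite fsumEFin // -(fimfunE _ x).
rewrite ge0_integral_fsum//; last 2 first.
  - by move=> y; apply: emeasurable_funM => //; exact/measurable_EFinP.
  - by move=> m y Ey; rewrite mule_ge0 ?nnfun_muleindic_ge0 ?lee_fin.
apply: eq_fsbigr => r rhn.
under eq_integral do rewrite EFinM.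
rewrite integralZl_indic_nnsfun => //.
under [RHS]eq_integral do rewrite EFinM -muleA.
rewrite ge0_integralZl//.
- under [in RHS]eq_integral do rewrite muleC.
  rewrite [in RHS](eq_integral ((EFin \o s) \_ (h n @^-1` [set r]))); last first.
    by move=> x xE; rewrite epatch_indic.
  by rewrite -integral_mkcond -nuE// integral_indic// setIT.
- by apply: emeasurable_funM; exact/measurable_EFinP.
- by move=> t Et; rewrite mule_ge0 ?lee_fin.
- by move: rhn; rewrite inE => -[t _ <-]; rewrite lee_fin.
Qed.

End change_of_density.

Section density_expectation.
Context {R : realType} d (T : measurableType d) dO (Om : measurableType dO).
Variables (mu : {measure set T -> \bar R}) (Y : {mfun Om >-> T}).
Variables (Q : probability Om R) (s : T -> R).
Hypotheses (s0 : forall x, 0 <= s x) (ms : measurable_fun setT s).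
Hypothesis s1 : (\int[mu]_x (s x)%:E = 1)%E.
Hypothesis QE : forall A, measurable A ->
  Q (Y @^-1` A) = (\int[mu]_(x in A) (s x)%:E)%E.

Lemma ge0_integral_has_density (f : T -> R) :
  (forall x, 0 <= f x) -> measurable_fun setT f ->
  (\int[Q]_w (f (Y w))%:E = \int[mu]_x (f x * s x)%:E)%E.
Proof.
move=> f0 mf; pose nu : {measure set T -> \bar R} := pushforward Q Y.
rewrite -(ge0_integral_density (nu := nu (measurable_funPT Y))) //.
rewrite /nu ge0_integral_pushforward //; last by move=> y _; rewrite lee_fin.
exact/measurable_EFinP.
Qed.

Lemma density_integrable : mu.-integrable setT (EFin \o s).
Proof.
apply/integrableP; split; first exact/measurable_EFinP.
under eq_integral => x _ do rewrite /= ger0_norm //.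
by rewrite s1 ltry.
Qed.

Lemma bounded_density_integrable (f : T -> R) (c : R) :
  measurable_fun setT f -> (forall x, `|f x| <= c) ->
  mu.-integrable setT (fun x => (f x * s x)%:E).
Proof.
move=> mf fc; apply: (le_integrable measurableT _ _
  (integrableZl measurableT c density_integrable)) => //.
  by apply/measurable_EFinP; exact: measurable_funM.
move=> x _ /=; rewrite lee_fin !normrM ler_wpM2r //.
by rewrite (le_trans (fc x)) // ler_norm.
Qed.

Lemma bounded_integrable (f : Om -> R) (c : R) :
  measurable_fun setT f -> (forall x, `|f x| <= c) ->
  Q.-integrable setT (EFin \o f).
Proof.
move=> mf fc.
apply: (le_integrable measurableT _ _
  (finite_measure_integrable_cst Q c measurableT)) => //.
  exact/measurable_EFinP.
by move=> x _ /=; rewrite lee_fin (le_trans (fc x)) // ler_norm.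
Qed.

(** Adding [c] makes [f] nonnegative; the shift cancels afterwards because [Q] and the density [s]
    both have total mass one. *)
Lemma Rintegral_has_density (f : T -> R) (c : R) :
  measurable_fun setT f -> (forall x, `|f x| <= c) ->
  \int[Q]_w f (Y w) = \int[mu]_x (f x * s x).
Proof.
move=> mf fc.
have mfY : measurable_fun setT (fun w => f (Y w)) by exact: measurableT_comp.
have fcc x : 0 <= f x + c.
  by have := fc x; rewrite ler_norml => /andP[]; lra.
have mfcc : measurable_fun setT (fun x => f x + c) by exact: measurable_funD.
have ic : Q.-integrable setT (EFin \o cst c).
  exact: (finite_measure_integrable_cst Q c measurableT).
have : \int[Q]_w (f (Y w) + c) = \int[mu]_x ((f x + c) * s x).
  by rewrite /Rintegral (ge0_integral_has_density fcc mfcc).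
rewrite RintegralD //; last first.
  by apply: (@bounded_integrable _ c) => // w; exact: fc.
rewrite Rintegral_cst //.
under [in RHS]eq_Rintegral => x _ do rewrite mulrDl.
rewrite RintegralD //; last 2 first.
- exact: (bounded_density_integrable mf fc).
- exact: (integrableZl measurableT c density_integrable).
rewrite RintegralZl //; last exact: density_integrable.
have -> : \int[mu]_x s x = 1 by rewrite /Rintegral s1.
have -> : c * fine (Q setT) = c * 1 by rewrite probability_setT.
exact: addIr.
Qed.

End density_expectation.

(** * Pointwise inequalities for psi *)

Section phi.
Context {R : realType}.
Implicit Types a b s t u : R.

(* The value of [psi] at the square root of a / b; the convention 0 / 0 = 0 of
   the field makes it agree with psi 1 = 0 and psi +oo = 1. *)
Definition phi a b : R := (Num.sqrt a - Num.sqrt b) / Num.sqrt (a + b).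

Lemma psi_quotE a b : 0 <= a -> 0 <= b -> psi (sqrte (quot a b)) = phi a b.
Proof.
move=> a0 b0; rewrite /quot /phi; case: (eqVneq b 0) => [->|bn0].
  rewrite sqrtr0 subr0 addr0; case: (eqVneq a 0) => [->|an0].
    by rewrite /= sqrtr1 subrr mul0r sqrtr0 mul0r.
  by rewrite /= divff // gt_eqF // sqrtr_gt0 lt0r an0.
have bp : 0 < b by rewrite lt0r bn0.
have sb : 0 < Num.sqrt b by rewrite sqrtr_gt0.
have ab : 0 <= a / b by rewrite divr_ge0.
rewrite /= sqr_sqrtr // sqrtrM // sqrtrV ?(ltW bp) //.
have -> : 1 + a / b = (a + b) / b by field.
rewrite sqrtrM ?addr_ge0 // sqrtrV ?(ltW bp) //.
have sab : Num.sqrt (a + b) != 0 by rewrite gt_eqF // sqrtr_gt0 ltr_wpDl.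
by field; rewrite ?sab ?gt_eqF.
Qed.

Lemma sqrtr_addr_ge0 a b : 0 <= a -> 0 <= b ->
  Num.sqrt (a + b) ^+ 2 = Num.sqrt a ^+ 2 + Num.sqrt b ^+ 2.
Proof. by move=> a0 b0; rewrite !sqr_sqrtr // addr_ge0. Qed.

Lemma phi_sqr a b : 0 <= a -> 0 <= b ->
  phi a b ^+ 2 * (a + b) = (Num.sqrt a - Num.sqrt b) ^+ 2.
Proof.
move=> a0 b0; have [ab0|ab0] := eqVneq (a + b) 0.
  have [-> ->] : a = 0 /\ b = 0 by split; lra.
  by rewrite !addr0 mulr0 subrr expr0n.
by rewrite /phi expr_div_n sqr_sqrtr ?addr_ge0 // divfK.
Qed.

Lemma phi_le1 a b : 0 <= a -> 0 <= b -> `|phi a b| <= 1.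
Proof.
move=> a0 b0; have [ab0|ab0] := eqVneq (a + b) 0.
  by rewrite /phi ab0 sqrtr0 invr0 mulr0 normr0 ler01.
have abp : 0 < a + b by rewrite lt0r ab0 addr_ge0.
rewrite -[leLHS]sqrtr_sqr -sqrtr1 ler_sqrt ?ltr01 //.
rewrite -(ler_pM2r abp) phi_sqr // mul1r.
have := sqr_sqrtr a0; have := sqr_sqrtr b0.
have := sqrtr_ge0 a; have := sqrtr_ge0 b; nra.
Qed.

Lemma phiC a b : phi b a = - phi a b.
Proof. by rewrite /phi (addrC b) -mulNr opprB. Qed.

(** This makes conditions of the form level < phi upward closed in the first argument. After
    cross-multiplication both sides carry the sign of a difference of square roots: equal signs
    allow the squares to be compared, opposite signs are immediate. *)
Lemma phi_mono a a' b : 0 <= a -> 0 <= b -> a <= a' -> phi a b <= phi a' b.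
Proof.
move=> a0 b0 aa'; have a'0 := le_trans a0 aa'.
have [ab0|ab0] := eqVneq (a + b) 0.
  have [-> ->] : a = 0 /\ b = 0 by split; lra.
  by rewrite /phi subrr mul0r sqrtr0 subr0 divr_ge0 // sqrtr_ge0.
have abp : 0 < a + b by rewrite lt0r ab0 addr_ge0.
have abp' : 0 < a' + b by rewrite (lt_le_trans abp) // lerD2r.
have r0 : 0 < Num.sqrt (a + b) by rewrite sqrtr_gt0.
have r0' : 0 < Num.sqrt (a' + b) by rewrite sqrtr_gt0.
have r2 := sqrtr_addr_ge0 a0 b0; have r2' := sqrtr_addr_ge0 a'0 b0.
have xx' : Num.sqrt a <= Num.sqrt a' by rewrite ler_wsqrtr.
have x0 := sqrtr_ge0 a; have x0' := sqrtr_ge0 a'; have y0 := sqrtr_ge0 b.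
rewrite /phi ler_pdivrMr // mulrAC ler_pdivlMr //.
move: r0 r0' r2 r2' xx' x0 x0' y0.
set r := Num.sqrt (a + b); set r' := Num.sqrt (a' + b).
set x := Num.sqrt a; set x' := Num.sqrt a'; set y := Num.sqrt b.
move=> r0 r0' r2 r2' xx' x0 x0' y0.
have [xy|yx] := leP x y; last first.
  have e : ((x - y) * r') ^+ 2 <= ((x' - y) * r) ^+ 2.
    rewrite !exprMn r2 r2' -subr_ge0.
    have -> : (x' - y) ^+ 2 * (x ^+ 2 + y ^+ 2) - (x - y) ^+ 2 * (x' ^+ 2 + y ^+ 2)
      = 2 * y * (x' - x) * (x * x' - y * y) by ring.
    apply: mulr_ge0; first by rewrite !mulr_ge0 ?subr_ge0.
    by rewrite subr_ge0 ler_pM // ltW // (lt_le_trans yx).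
  rewrite ler_sqr ?nnegrE in e => //.
  - by rewrite mulr_ge0 ?ltW // subr_gt0.
  - by rewrite mulr_ge0 ?(ltW r0) // subr_ge0 (le_trans (ltW yx)).
have [x'y|yx'] := leP x' y; last first.
  apply: (@le_trans _ _ 0).
    by rewrite mulr_le0_ge0 ?(ltW r0') // subr_le0.
  by rewrite mulr_ge0 ?(ltW r0) // subr_ge0 ltW.
have e : ((y - x') * r) ^+ 2 <= ((y - x) * r') ^+ 2.
  rewrite !exprMn r2 r2' -subr_ge0.
  have -> : (y - x) ^+ 2 * (x' ^+ 2 + y ^+ 2) - (y - x') ^+ 2 * (x ^+ 2 + y ^+ 2)
      = 2 * y * (x' - x) * (y * y - x * x') by ring.
  apply: mulr_ge0; first by rewrite !mulr_ge0 ?subr_ge0.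
  by rewrite subr_ge0 ler_pM.
have {}e : (y - x') * r <= (y - x) * r'.
  rewrite ler_sqr ?nnegrE in e => //; rewrite mulr_ge0 ?subr_ge0 ?(ltW r0) ?(ltW r0') //.
lra.
Qed.

Lemma measurable_sqrt d (T : measurableType d) (f : T -> R) :
  measurable_fun setT f -> measurable_fun setT (fun x => Num.sqrt (f x)).
Proof.
move=> mf; apply: (measurableT_comp _ mf).
by apply: continuous_measurable_fun; exact: sqrt_continuous.
Qed.

Lemma measurable_phi d (T : measurableType d) (f g : T -> R) :
  measurable_fun setT f -> measurable_fun setT g ->
  measurable_fun setT (fun x => phi (f x) (g x)).
Proof.
move=> mf mg.
have -> : (fun x => phi (f x) (g x)) =
    (fun x => (Num.sqrt (f x) - Num.sqrt (g x)) * (Num.sqrt (f x + g x)) `^ (-1)).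
  by apply/funext => x; rewrite powR_inv1 // sqrtr_ge0.
apply: measurable_funM.
  by apply: measurable_funB; exact: measurable_sqrt.
apply: (measurableT_comp (measurable_powR (-1))).
by apply: measurable_sqrt; exact: measurable_funD.
Qed.

(** Since phi^2 (u + t) is the squared difference of the roots, phi^2 t is controlled; [s] is
    exchanged for [t] by s <= 2 (sqrt s - sqrt t)^2 + 2 t, the first term using phi^2 <= 1. *)
Lemma phi_second_moment s t u : 0 <= s -> 0 <= t -> 0 <= u ->
  phi u t ^+ 2 * s <=
  6 * (Num.sqrt s - Num.sqrt t) ^+ 2 + 4 * (Num.sqrt s - Num.sqrt u) ^+ 2.
Proof.
move=> s0 t0 u0.
have e := phi_sqr u0 t0.
have p1 : phi u t ^+ 2 <= 1 by rewrite -real_normK ?num_real // expr_le1 // phi_le1.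
have p0 := sqr_ge0 (phi u t).
have := sqr_sqrtr s0; have := sqr_sqrtr t0.
move: p1 p0 e; set p := phi u t ^+ 2; set x := Num.sqrt s; set y := Num.sqrt t.
set z := Num.sqrt u => p1 p0 e et es.
have sle : s <= 2 * (x - y) ^+ 2 + 2 * t by rewrite -es -et; have := sqr_ge0 (x - 2 * y); lra.
have pt : p * t <= (z - y) ^+ 2 by rewrite -e; nra.
have ps : p * s <= p * (2 * (x - y) ^+ 2 + 2 * t) by rewrite ler_wpM2l.
have pxy : p * (x - y) ^+ 2 <= (x - y) ^+ 2 by rewrite ler_piMl // sqr_ge0.
have : (z - y) ^+ 2 <= 2 * (x - y) ^+ 2 + 2 * (x - z) ^+ 2.
  by have := sqr_ge0 (2 * x - y - z); lra.
lra.
Qed.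

Lemma sqrt_mid_ge t u : 0 <= t -> 0 <= u ->
  (Num.sqrt t + Num.sqrt u) / 2 <= Num.sqrt ((t + u) / 2).
Proof.
move=> t0 u0.
have h0 : 0 <= (Num.sqrt t + Num.sqrt u) / 2.
  by rewrite divr_ge0 // addr_ge0 // sqrtr_ge0.
rewrite -[leLHS]ger0_norm // -sqrtr_sqr ler_sqrt; last by rewrite divr_ge0 // addr_ge0.
have := sqr_sqrtr t0; have := sqr_sqrtr u0.
have := sqr_ge0 (Num.sqrt t - Num.sqrt u); lra.
Qed.

(* With r the midpoint of t and u, the left-hand side is
   sqrt(s u) - sqrt(s t) + ((sqrt u - sqrt t) / sqrt r) (sqrt s - sqrt r)^2 / 2. *)
Lemma mean_stat_pointwise s t u : 0 <= s -> 0 <= t -> 0 <= u ->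
  2^-1 * (Num.sqrt (u * ((t + u) / 2)) - Num.sqrt (t * ((t + u) / 2)))
    + (Num.sqrt 2)^-1 * (phi u t * s) <=
  2^-1 * (1 + (Num.sqrt 2)^-1) * (Num.sqrt s - Num.sqrt t) ^+ 2
  - 2^-1 * (1 - (Num.sqrt 2)^-1) * (Num.sqrt s - Num.sqrt u) ^+ 2
  + 2^-1 * (u - t).
Proof.
move=> s0 t0 u0.
have k0 : 0 < Num.sqrt 2 :> R by rewrite sqrtr_gt0.
have k2 : Num.sqrt 2 ^+ 2 = 2 :> R by rewrite sqr_sqrtr.
pose r := (t + u) / 2; rewrite -/r.
have r0 : 0 <= r by rewrite divr_ge0 // addr_ge0.
have tuE : u + t = 2 * r by rewrite /r; field.
have phiE : phi u t = (Num.sqrt 2)^-1 * ((Num.sqrt u - Num.sqrt t) / Num.sqrt r).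
  by rewrite /phi tuE sqrtrM // invfM; ring.
have r2 := sqr_sqrtr r0; have x2 := sqr_sqrtr s0.
have y2 := sqr_sqrtr t0; have z2 := sqr_sqrtr u0.
have mid := sqrt_mid_ge t0 u0; rewrite -/r in mid.
have ph1 := phi_le1 u0 t0.
rewrite (sqrtrM r u0) (sqrtrM r t0).
have q0 : 0 <= Num.sqrt s by exact: sqrtr_ge0.
move: k0 k2 phiE r2 x2 y2 z2 mid ph1 q0.
set k := Num.sqrt 2; set p := phi u t; set w := Num.sqrt r; set x := Num.sqrt s.
set y := Num.sqrt t; set z := Num.sqrt u.
move=> k0 k2 phiE w2 x2 y2 z2 mid ph1 q0.
have id : 2^-1 * (z * w - y * w) + k^-1 * (p * s) =
    x * z - x * y + k^-1 * p * (x - w) ^+ 2.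
  have kk : k^-1 * k^-1 = 2^-1 :> R by rewrite -invfM -expr2 k2.
  have [wE|wn0] := eqVneq w 0.
    have p0 : p = 0 by rewrite phiE wE invr0 !mulr0.
    have [y0 z0] : y = 0 /\ z = 0.
      have : 0 <= y by exact: sqrtr_ge0.
      have : 0 <= z by exact: sqrtr_ge0.
      by move: mid; rewrite wE => ? ? ?; split; lra.
    by rewrite p0 y0 z0; ring.
  have -> : k^-1 * (p * s) = 2^-1 * ((z - y) / w) * s by rewrite phiE -kk; ring.
  have -> : k^-1 * p = 2^-1 * ((z - y) / w) by rewrite phiE -kk; ring.
  by rewrite -x2; field.
rewrite id.
have kp : k^-1 * p <= k^-1.
  rewrite ler_piMr ?invr_ge0 ?(ltW k0) //.
  by move: ph1; rewrite ler_norml => /andP[].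
have c1 : k^-1 * p * (x - w) ^+ 2 <= k^-1 * (x - w) ^+ 2.
  by rewrite ler_wpM2r // sqr_ge0.
(* The square w^2 is exactly the mean of y^2 and z^2, while w >= (y + z) / 2 by concavity of the
   square root, and x >= 0. *)
have c2 : (x - w) ^+ 2 <= 2^-1 * (x - y) ^+ 2 + 2^-1 * (x - z) ^+ 2.
  have : w ^+ 2 = (y ^+ 2 + z ^+ 2) / 2 by rewrite w2 y2 z2.
  nra.
have c3 : k^-1 * (x - w) ^+ 2 <= k^-1 * (2^-1 * (x - y) ^+ 2 + 2^-1 * (x - z) ^+ 2).
  by rewrite ler_wpM2l // invr_ge0 ltW.
rewrite -y2 -z2; lra.
Qed.

End phi.

(** * Symmetrization with a quadratic offset *)

Lemma expR_le_quad (R : realType) (x : R) : x <= 2^-1 -> expR x <= 1 + x + 2 * x ^+ 2.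
Proof.
move=> x2; have y0 : 0 < 1 - x by lra.
have h1 : 1 - x <= (expR x)^-1 by rewrite -expRN; have := expR_ge1Dx (- x).
have h2 : expR x <= (1 - x)^-1.
  by rewrite -[leLHS]invrK lef_pV2 // posrE ?invr_gt0 ?expR_gt0.
apply: le_trans h2 _; rewrite -[leLHS]mul1r ler_pdivrMr //.
rewrite -subr_ge0.
have -> : (1 + x + 2 * x ^+ 2) * (1 - x) - 1 = x ^+ 2 * (1 - 2 * x) by ring.
by rewrite mulr_ge0 ?sqr_ge0 //; lra.
Qed.

(* With b the ghost copy of a, the mean of [offset_diff] is a centred variable
   minus 2c times its second moment; this offset pays for the exponential moment. *)
Definition offset_diff {R : realType} (c a b : R) := a - b - 2 * c * b ^+ 2.

(** The linear terms a - b and b - a cancel in the sum. With exponent lam, the offsets contribute -2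
    lam c (a^2 + b^2) and the second-order terms at most 32 lam^2 (a^2 + b^2). This asks for lam <=
    c / 16, and c / 36 leaves room. *)
Lemma offset_diff_exp (R : realType) (c a b : R) :
  0 < c -> c <= 1 -> `|a| <= 1 -> `|b| <= 1 ->
  expR (c / 36 * offset_diff c a b) + expR (c / 36 * offset_diff c b a) <= 2.
Proof.
move=> c0 c1; rewrite !ler_norml => /andP[a1 a2] /andP[b1 b2].
have aux (u v : R) : -1 <= u -> u <= 1 -> -1 <= v -> v <= 1 ->
    c / 36 * offset_diff c u v <= 2^-1 /\
    offset_diff c u v ^+ 2 <= 4 * u ^+ 2 + 12 * v ^+ 2.
  move=> u1 u2 v1 v2; rewrite /offset_diff.
  have v20 := sqr_ge0 v; have u20 := sqr_ge0 u.
  have v21 : v ^+ 2 <= 1 by nra.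
  have cv0 : 0 <= c * v ^+ 2 by rewrite mulr_ge0 // ltW.
  have cv1 : c * v ^+ 2 <= v ^+ 2 by rewrite ler_piMl.
  split; first by nra.
  have : (c * v ^+ 2) ^+ 2 <= v ^+ 2 by nra.
  have := sqr_ge0 (u - v + 2 * (c * v ^+ 2)); have := sqr_ge0 (u + v).
  nra.
have [h1 h2] := aux a b a1 a2 b1 b2; have [h3 h4] := aux b a b1 b2 a1 a2.
have := expR_le_quad h1; have := expR_le_quad h3.
set E1 := expR _; set E2 := expR _ => e1 e2.
have : E1 + E2 <= 2 - 2 * (c / 36) * c * (a ^+ 2 + b ^+ 2)
   + 2 * (c / 36) ^+ 2 * (16 * (a ^+ 2 + b ^+ 2)).
  rewrite !exprMn in e1 e2.
  have c2 : 0 <= (c / 36) ^+ 2 by exact: sqr_ge0.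
  have g1 := ler_wpM2l c2 h2; have g2 := ler_wpM2l c2 h4.
  move: e1 e2 g1 g2; rewrite /offset_diff; lra.
have : 0 <= a ^+ 2 + b ^+ 2 by rewrite addr_ge0 ?sqr_ge0.
have : 0 <= c ^+ 2 by rewrite sqr_ge0.
nra.
Qed.

(** The linear part accounts for 2 [del], the quadratic part for 4 [del]. *)
Lemma offset_diff_lip (R : realType) (c del a b a' b' : R) :
  0 < c -> c <= 1 -> `|b| <= 1 -> `|b'| <= 1 ->
  `|a - a'| <= del -> `|b - b'| <= del ->
  offset_diff c a b <= offset_diff c a' b' + 6 * del.
Proof.
move=> c0 c1; rewrite !ler_norml => /andP[b1 b2] /andP[b1' b2'].
move=> /andP[_ ha] /andP[hb1 hb2]; rewrite /offset_diff.
suff : c * (b' ^+ 2 - b ^+ 2) <= 2 * del by lra.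
have d0 : 0 <= del by lra.
suff : b' ^+ 2 - b ^+ 2 <= 2 * del.
  move=> h; apply: le_trans (ler_wpM2l (ltW c0) h) _.
  by rewrite ler_piMl // mulr_ge0.
nra.
Qed.

Lemma measurable_ereal_sup_range d (T : measurableType d) (R : realType)
    (f : nat -> T -> \bar R) : (forall k, measurable_fun setT (f k)) ->
  measurable_fun setT (fun x => ereal_sup (range (fun k => f k x))).
Proof.
move=> mf; rewrite (_ : (fun x => _) = (fun x => esups (f ^~ x) 0)).
  exact: measurable_fun_esups.
apply/funext => x; congr ereal_sup; rewrite /sdrop.
by apply/seteqP; split=> _ [k _ <-]; exists k.
Qed.

Lemma expR_Jensen d (T : measurableType d) (R : realType) (Q : probability T R)
    (G : T -> R) (M : R) : measurable_fun setT G -> (forall x, `|G x| <= M) ->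
  ((expR (\int[Q]_x G x))%:E <= \int[Q]_x (expR (G x))%:E)%E.
Proof.
move=> mG GM; set m := \int[Q]_x G x.
have iG : Q.-integrable setT (EFin \o G) by exact: bounded_integrable mG GM.
have mE : measurable_fun setT (fun x => expR (G x)) by exact: measurableT_comp.
have iE : Q.-integrable setT (EFin \o (fun x => expR (G x))).
  apply: (@bounded_integrable _ _ _ _ _ (expR M) mE) => x.
  rewrite ger0_norm ?expR_ge0 // ler_expR.
  by rewrite (le_trans _ (GM x)) // ler_norm.
have -> : (\int[Q]_x (expR (G x))%:E = (\int[Q]_x expR (G x))%:E)%E.
  by rewrite /Rintegral fineK //; exact: integrable_fin_num iE.
rewrite lee_fin.
have ic (k : R) : Q.-integrable setT (EFin \o cst k).
  exact: (finite_measure_integrable_cst Q k measurableT).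
have iZ : Q.-integrable setT (EFin \o (fun x => expR m * G x)).
  exact: (integrableZl measurableT (expR m) iG).
(* The right-hand side integrates the tangent line of exp at the mean [m], which lies below exp. *)
have -> : expR m = \int[Q]_x (cst (expR m * (1 - m)) x + expR m * G x).
  rewrite RintegralD // RintegralZl // Rintegral_cst //.
  have -> : fine (Q setT) = 1 by rewrite probability_setT.
  by rewrite -/m; ring.
apply: le_Rintegral => //.
  by apply: (integrableD measurableT (ic _) iZ).
move=> x _ /=.
have := expR_ge1Dx (G x - m) => h.
have -> : expR (G x) = expR m * expR (G x - m) by rewrite -expRD addrC subrK.
by rewrite -mulrDr ler_wpM2l ?expR_ge0 //; lra.
Qed.

Section ghost_sample.
Context {R : realType} {n : nat} {d : 'I_n -> measure_display}.
Context {X : forall i : 'I_n, measurableType (d i)}.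
Context {dO : measure_display} {Om : measurableType dO}.
Variable Xv : forall i : 'I_n, {mfun Om >-> X i}.
Variable Q : probability Om R.
Hypothesis indep : independent Xv Q.

Definition pair_rect (B B' : forall i, set (X i)) : set (forall i, (X i * X i)%type) :=
  [set z | forall i, B i (z i).1 /\ B' i (z i).2].

Definition pair_rects : set (set (forall i, (X i * X i)%type)) :=
  [set A | exists B B', [/\ forall i, measurable (B i),
                            forall i, measurable (B' i) & A = pair_rect B B']].

(** The sigma-algebra is generated by rectangles so that a law is determined on a pi-system, where
    independence computes it as a product. *)
Definition pairs := g_sigma_algebraType pair_rects.

Definition swap_pairs (e : 'I_n -> bool) (w : Om * Om) : pairs :=
  fun i => if e i then (Xv i w.1, Xv i w.2) else (Xv i w.2, Xv i w.1).

Lemma swap_pairs_preimage e B B' :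
  swap_pairs e @^-1` pair_rect B B' =
  (\bigcap_i (Xv i @^-1` (if e i then B i else B' i))) `*`
  (\bigcap_i (Xv i @^-1` (if e i then B' i else B i))).
Proof.
apply/seteqP; split=> [w wB|w [w1 w2] i].
  by split=> i _ /=; have := wB i; rewrite /swap_pairs; case: (e i) => -[].
have := w1 i I; have := w2 i I; rewrite /swap_pairs /=.
by case: (e i).
Qed.

Lemma measurable_sample_bigcap (B : forall i, set (X i)) :
  (forall i, measurable (B i)) -> measurable (\bigcap_i (Xv i @^-1` B i)).
Proof.
move=> mB; apply: fin_bigcap_measurable => // i _.
by rewrite -[_ @^-1` _]setTI; exact: measurable_funPT.
Qed.

Lemma sample_bigcap_prob (B : forall i, set (X i)) :
  (forall i, measurable (B i)) ->
  Q (\bigcap_i (Xv i @^-1` B i)) = (\prod_i Q (Xv i @^-1` B i))%E.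
Proof.
move=> mB; have := indep [set: 'I_n]%SET mB.
rewrite (_ : [set i | _] = setT); last by apply/seteqP; split=> // i _; rewrite /= inE.
by move=> ->; apply: eq_bigl => i; rewrite inE.
Qed.

Lemma measurable_swap_pairs e : measurable_fun setT (swap_pairs e).
Proof.
apply: (@measurability _ _ _ pairs _ _ pair_rects) => // _ [_ [B [B' [mB mB' ->]]] <-].
rewrite setTI swap_pairs_preimage; apply: measurableX;
  by apply: measurable_sample_bigcap => i; case: (e i).
Qed.

Lemma swap_pairs_prob e B B' :
  (forall i, measurable (B i)) -> (forall i, measurable (B' i)) ->
  (Q \x Q)%E (swap_pairs e @^-1` pair_rect B B') =
  (\prod_i (Q (Xv i @^-1` B i) * Q (Xv i @^-1` B' i)))%E.
Proof.
move=> mB mB'; rewrite swap_pairs_preimage product_measure1E; last 2 first.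
- by apply: measurable_sample_bigcap => i; case: (e i).
- by apply: measurable_sample_bigcap => i; case: (e i).
transitivity ((\prod_i Q (Xv i @^-1` (if e i then B i else B' i))) *
              (\prod_i Q (Xv i @^-1` (if e i then B' i else B i))))%E.
  congr (_ * _)%E; apply: (@sample_bigcap_prob (fun i => if e i then _ else _));
    by move=> i; case: (e i).
by rewrite -big_split; apply: eq_bigr => i _; case: (e i) => //=; rewrite muleC.
Qed.

(** On a rectangle each image law is the product of the factors Q(B i) Q(B' i), in which a swap only
    permutes two factors; uniqueness on the pi-system of rectangles extends this to all measurable
    sets. *)
Lemma integral_swap_pairs e e' (F : pairs -> \bar R) :
  measurable_fun setT F -> (forall z, 0 <= F z)%E ->
  (\int[(Q \x Q)%E]_w F (swap_pairs e w) = \int[(Q \x Q)%E]_w F (swap_pairs e' w))%E.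
Proof.
move=> mF F0.
pose nu b : {measure set pairs -> \bar R} := pushforward (Q \x Q)%E (swap_pairs b).
have push b : (\int[(Q \x Q)%E]_w F (swap_pairs b w) =
    \int[nu measurable_swap_pairs b]_z F z)%E.
  by rewrite /nu ge0_integral_pushforward //; exact: measurable_swap_pairs.
rewrite !push; apply: eq_measure_integral => A mA _.
apply: (@measure_unique _ _ pairs pair_rects (fun=> setT)) => //.
- move=> _ _ [B [B' [mB mB' ->]]] [C [C' [mC mC' ->]]].
  exists (fun i => B i `&` C i), (fun i => B' i `&` C' i); split.
  + by move=> i; exact: measurableI.
  + by move=> i; exact: measurableI.
  + apply/seteqP; split=> [z [zB zC] i|z zBC].
      by have [? ?] := zB i; have [? ?] := zC i.
    by split=> i; have [[? ?] [? ?]] := zBC i.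
- move=> _; exists (fun=> setT), (fun=> setT); split=> //.
  by apply/seteqP; split.
- by apply/seteqP; split=> // x _; exists 0%N.
- move=> _ [B [B' [mB mB' ->]]].
  transitivity (\prod_i (Q (Xv i @^-1` B i) * Q (Xv i @^-1` B' i)))%E.
    exact: swap_pairs_prob.
  exact/esym/swap_pairs_prob.
- move=> _; rewrite /nu /= /pushforward preimage_setT -setXTT.
  apply: (@le_lt_trans _ _ (Q setT * Q setT)%E).
    by rewrite product_measure1E.
  by rewrite !probability_setT mule1 ltry.
Qed.

End ghost_sample.

Lemma Rintegral_sum d (T : measurableType d) (R : realType)
    (mu : {measure set T -> \bar R}) (I : Type) (s : seq I) (g : I -> T -> R) :
  (forall i, mu.-integrable setT (EFin \o g i)) ->
  \int[mu]_x (\sum_(i <- s) g i x) = \sum_(i <- s) \int[mu]_x g i x.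
Proof.
move=> ig; have isum r : mu.-integrable setT (EFin \o (fun x => \sum_(i <- r) g i x)).
  rewrite (_ : EFin \o _ = (fun x => \sum_(i <- r) (g i x)%:E)%E).
    apply: (@integrable_sum _ _ _ _ _ measurableT _ _ _ (fun i x => (g i x)%:E)).
    by move=> i _; exact: ig.
  by apply/funext => x; rewrite /= sumEFin.
elim: s => [|i s IH].
  under eq_Rintegral do rewrite big_nil.
  by rewrite big_nil /Rintegral integral0.
rewrite big_cons -IH -RintegralD //.
by apply: eq_Rintegral => x _; rewrite big_cons.
Qed.

Lemma Rintegral_offset_diff d (T : measurableType d) (R : realType)
    (Q : probability T R) (g : T -> R) (c a : R) :
  measurable_fun setT g -> (forall x, `|g x| <= 1) ->
  \int[Q]_x offset_diff c a (g x) = a - \int[Q]_x g x - 2 * c * \int[Q]_x (g x ^+ 2).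
Proof.
move=> mg g1.
have ig : Q.-integrable setT (EFin \o g) by exact: bounded_integrable mg g1.
have ig2 : Q.-integrable setT (EFin \o (fun x => g x ^+ 2)).
  apply: (@bounded_integrable _ _ _ _ _ 1); first exact: measurable_funX.
  by move=> x; rewrite normrX expr_le1.
have ic : Q.-integrable setT (EFin \o cst a).
  exact: (finite_measure_integrable_cst Q a measurableT).
have iZ : Q.-integrable setT (EFin \o (fun x => 2 * c * g x ^+ 2)).
  exact: (integrableZl measurableT (2 * c) ig2).
rewrite -RintegralZl // -[X in X - _ - _](_ : \int[Q]_x cst a x = a); last first.
  rewrite Rintegral_cst //.
  by have -> : a * fine (Q setT) = a by rewrite probability_setT /= mulr1.
rewrite -RintegralB // -RintegralB //.
exact: (integrableB measurableT ic ig).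
Qed.

Section symmetrization.
Context {R : realType} {n : nat} {d : 'I_n -> measure_display}.
Context {X : forall i : 'I_n, measurableType (d i)}.
Context {dO : measure_display} {Om : measurableType dO}.
Variable Xv : forall i : 'I_n, {mfun Om >-> X i}.
Variable Q : probability Om R.
Hypothesis indep : independent Xv Q.
Variable f : nat -> forall i, X i -> R.
Arguments f : clear implicits.
Hypothesis mf : forall k i, measurable_fun setT (f k i).
Hypothesis f1 : forall k i x, `|f k i x| <= 1.
Variables c del N : R.
Hypotheses (c0 : 0 < c) (c1 : c <= 1).
Hypothesis cover : forall w1 w2 : Om, exists r : seq nat, (size r)%:R <= N /\
  forall k, exists2 k', k' \in r & forall i,
    `|f k i (Xv i w1) - f k' i (Xv i w1)| <= del /\
    `|f k i (Xv i w2) - f k' i (Xv i w2)| <= del.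

Let lam := c / 36.
Local Notation pairs := (@pairs n d X).

Definition pair_offset k (z : pairs) : R :=
  \sum_i offset_diff c (f k i (z i).1) (f k i (z i).2).

Definition sup_pair_offset (z : pairs) : \bar R :=
  ereal_sup (range (fun k => (expR (lam * pair_offset k z))%:E)).

Lemma measurable_pair_coord i :
  measurable_fun setT (fun z : pairs => (z i).1) /\
  measurable_fun setT (fun z : pairs => (z i).2).
Proof.
(* The box has side [A] at [i] and full sides elsewhere. As the types [X j] vary with [j], [A] is
   transported along i = j. *)
have cyl (A : set (X i)) : measurable A -> exists B : forall j, set (X j),
    (forall j, measurable (B j)) /\ forall x : forall j, X j, (forall j, B j (x j)) <-> A (x i).
  move=> mA; exists (fun j => match pselect (i = j) with
    left e => eq_rect i (fun k => set (X k)) A j e | right _ => setT end); split.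
    by move=> j; case: pselect => // e; case: _ / e.
  move=> x; split=> [/(_ i)|Ax j].
    by case: pselect => // e; rewrite (eq_axiomK e).
  by case: pselect => // e; case: _ / e.
split=> _ A /cyl[B [mB BA]]; rewrite setTI; apply: sub_sigma_algebra.
  exists B, (fun=> setT); split=> //; apply/seteqP; split=> z /= zA.
    by move=> j; split=> //; exact: ((BA (fun j => (z j).1)).2 zA j).
  by apply: (BA (fun j => (z j).1)).1 => j; have [] := zA j.
exists (fun=> setT), B; split=> //; apply/seteqP; split=> z /= zA.
  by move=> j; split=> //; exact: ((BA (fun j => (z j).2)).2 zA j).
by apply: (BA (fun j => (z j).2)).1 => j; have [] := zA j.
Qed.

Lemma measurable_sup_pair_offset : measurable_fun setT sup_pair_offset.
Proof.
apply: measurable_ereal_sup_range => k; apply/measurable_EFinP.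
apply: measurableT_comp => //; apply: measurable_funM => //.
apply: measurable_sum => i; rewrite /offset_diff.
have [m1 m2] := measurable_pair_coord i.
have mf1 : measurable_fun setT (fun z : pairs => f k i (z i).1).
  exact: (measurableT_comp (@mf k i) m1).
have mf2 : measurable_fun setT (fun z : pairs => f k i (z i).2).
  exact: (measurableT_comp (@mf k i) m2).
apply: measurable_funB; first exact: measurable_funB.
by apply: measurable_funM => //; exact: measurable_funX.
Qed.

Lemma sup_pair_offset_ge0 z : (0 <= sup_pair_offset z)%E.
Proof.
apply: (@le_trans _ _ (expR (lam * pair_offset 0 z))%:E).
  by rewrite lee_fin expR_ge0.
by apply: ereal_sup_ubound; exists 0%N.
Qed.

(** The sum over all swap patterns factors over the coordinates, and each factor is a two-term sum
    of the kind bounded by 2 in [offset_diff_exp]. *)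
Lemma pair_offset_sign_sum k (w : Om * Om) :
  \sum_(e : {ffun 'I_n -> bool}) expR (lam * pair_offset k (swap_pairs Xv e w))
  <= 2 ^+ n.
Proof.
pose E i (b : bool) := expR (lam * (if b
  then offset_diff c (f k i (Xv i w.1)) (f k i (Xv i w.2))
  else offset_diff c (f k i (Xv i w.2)) (f k i (Xv i w.1)))).
have -> : \sum_(e : {ffun 'I_n -> bool})
    expR (lam * pair_offset k (swap_pairs Xv e w)) =
    \sum_(e : {ffun 'I_n -> bool}) \prod_i E i (e i).
  apply: eq_bigr => e _; rewrite /pair_offset mulr_sumr expR_sum.
  by apply: eq_bigr => i _; rewrite /E /swap_pairs; case: (e i).
rewrite -bigA_distr_bigA -[in leRHS](card_ord n) -prodr_const.
apply: ler_prod => i _; rewrite big_bool /E /=.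
by rewrite addr_ge0 ?expR_ge0 //= offset_diff_exp.
Qed.

(** One list [r] serves every [e], since a swap evaluates the same functions at the same points. The
    supremum is then at most a constant times a sum over [r], which can be exchanged with the sum
    over swaps. *)
Lemma sup_pair_offset_sign_sum (w : Om * Om) :
  (\sum_(e : {ffun 'I_n -> bool}) sup_pair_offset (swap_pairs Xv e w) <=
   (2 ^+ n * (N * expR (lam * (n%:R * (6 * del)))))%:E)%E.
Proof.
have [r [rN rP]] := cover w.1 w.2.
set K := expR (lam * (n%:R * (6 * del))).
have l0 : 0 <= lam by rewrite divr_ge0 // ltW.
have bnd (e : {ffun 'I_n -> bool}) : (sup_pair_offset (swap_pairs Xv e w) <=
    (K * \sum_(k <- r) expR (lam * pair_offset k (swap_pairs Xv e w)))%:E)%E.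
  apply: ge_ereal_sup => _ [k _ <-]; rewrite lee_fin.
  have [k' k'r kk'] := rP k.
  apply: (@le_trans _ _ (K * expR (lam * pair_offset k' (swap_pairs Xv e w)))).
    rewrite -expRD ler_expR -mulrDr ler_wpM2l //.
    have -> : n%:R * (6 * del) = \sum_(i < n) (6 * del).
      by rewrite sumr_const card_ord mulr_natl.
    rewrite -big_split; apply: ler_sum => i _ /=; rewrite addrC.
    have [h1 h2] := kk' i.
    by rewrite /swap_pairs; case: (e i); apply: offset_diff_lip.
  rewrite ler_wpM2l ?expR_ge0 // (big_rem k') //= lerDl.
  by apply: sumr_ge0 => j _; exact: expR_ge0.
apply: le_trans (lee_sum _ (fun e _ => bnd e)) _.
rewrite sumEFin lee_fin -mulr_sumr exchange_big /=.
apply: (@le_trans _ _ (K * \sum_(k <- r) 2 ^+ n)).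
  rewrite ler_wpM2l ?expR_ge0 //; apply: ler_sum => k _.
  exact: pair_offset_sign_sum.
rewrite big_const_seq count_predT iter_addr_0.
rewrite -[_ *+ size r]mulr_natr.
have -> : K * (2 ^+ n * (size r)%:R) = 2 ^+ n * ((size r)%:R * K) by ring.
by rewrite ler_wpM2l ?exprn_ge0 // ler_wpM2r ?expR_ge0.
Qed.

Definition offset_proc k (w : Om) : R :=
  \sum_i (f k i (Xv i w) - \int[Q]_v f k i (Xv i v)
          - 2 * c * \int[Q]_v (f k i (Xv i v) ^+ 2)).

Definition sup_offset (w : Om) : \bar R :=
  ereal_sup (range (fun k => (expR (lam * offset_proc k w))%:E)).

Lemma measurable_coord k i : measurable_fun setT (fun w => f k i (Xv i w)).
Proof. exact: (measurableT_comp (@mf k i)). Qed.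

Lemma measurable_sup_offset : measurable_fun setT sup_offset.
Proof.
apply: measurable_ereal_sup_range => k; apply/measurable_EFinP.
apply: measurableT_comp => //; apply: measurable_funM => //.
apply: measurable_sum => i.
by apply: measurable_funB => //; apply: measurable_funB => //; exact: measurable_coord.
Qed.

Lemma sup_offset_ge0 w : (0 <= sup_offset w)%E.
Proof.
apply: (@le_trans _ _ (expR (lam * offset_proc 0 w))%:E).
  by rewrite lee_fin expR_ge0.
by apply: ereal_sup_ubound; exists 0%N.
Qed.

(** For fixed [w], [offset_proc] is the mean of [pair_offset] over the ghost sample. Jensen's
    inequality takes this mean outside exp, and only then is each index bounded by the supremum. *)
Lemma sup_offset_le_ghost w :
  (sup_offset w <=
   \int[Q]_v sup_pair_offset (swap_pairs Xv (fun=> true) (w, v)))%E.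
Proof.
apply: ge_ereal_sup => _ [k _ <-].
pose G v := lam * pair_offset k (swap_pairs Xv (fun=> true) (w, v)).
have l0 : 0 <= lam by rewrite divr_ge0 // ltW.
have mof i : measurable_fun setT
    (fun v => offset_diff c (f k i (Xv i w)) (f k i (Xv i v))).
  rewrite /offset_diff; apply: measurable_funB.
    by apply: measurable_funB => //; exact: measurable_coord.
  by apply: measurable_funM => //; apply: measurable_funX; exact: measurable_coord.
have of4 i v : `|offset_diff c (f k i (Xv i w)) (f k i (Xv i v))| <= 4.
  have := @f1 k i (Xv i w); have := @f1 k i (Xv i v).
  set a := f k i (Xv i w); set b := f k i (Xv i v); rewrite !ler_norml /offset_diff.
  move=> /andP[b1 b2] /andP[a1 a2].
  have b21 : b ^+ 2 <= 1 by nra.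
  have cb0 : 0 <= c * b ^+ 2 by rewrite mulr_ge0 ?sqr_ge0 // ltW.
  have cb1 : c * b ^+ 2 <= b ^+ 2 by rewrite ler_piMl // sqr_ge0.
  by apply/andP; split; lra.
have mG : measurable_fun setT G.
  by apply: measurable_funM => //; apply: measurable_sum => i; exact: mof.
have GM v : `|G v| <= lam * (\sum_(i < n) 4).
  rewrite normrM (ger0_norm l0) ler_wpM2l //.
  apply: le_trans (ler_norm_sum _ _ _) _; apply: ler_sum => i _; exact: of4.
have <- : \int[Q]_v G v = lam * offset_proc k w.
  rewrite RintegralZl //; last first.
    apply: (@bounded_integrable _ _ _ _ _ (\sum_(i < n) 4)).
      by apply: measurable_sum => i; exact: mof.
    move=> v; apply: le_trans (ler_norm_sum _ _ _) _.
    by apply: ler_sum => i _; exact: of4.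
  congr (_ * _); rewrite /pair_offset /swap_pairs /= Rintegral_sum; last first.
    by move=> i; apply: (@bounded_integrable _ _ _ _ _ 4); [exact: mof|exact: of4].
  apply: eq_bigr => i _; rewrite Rintegral_offset_diff //.
  exact: measurable_coord.
apply: le_trans (expR_Jensen Q mG GM) _.
apply: ge0_le_integral => //.
- by apply/measurable_EFinP; exact: measurableT_comp.
- apply: (measurableT_comp measurable_sup_pair_offset).
  apply: (measurableT_comp (measurable_swap_pairs Xv (fun=> true))).
  exact: pair1_measurable.
- by move=> v _; apply: ereal_sup_ubound; exists k.
Qed.

Lemma integral_sup_offset :
  (\int[Q]_w sup_offset w <= (N * expR (lam * (n%:R * (6 * del))))%:E)%E.
Proof.
pose F e (w : Om * Om) := sup_pair_offset (swap_pairs Xv e w).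
have mF e : measurable_fun setT (F e).
  exact: (measurableT_comp measurable_sup_pair_offset (measurable_swap_pairs Xv e)).
have F0 e w : (0 <= F e w)%E by exact: sup_pair_offset_ge0.
pose e0 : 'I_n -> bool := fun=> true.
apply: (@le_trans _ _ (\int[(Q \x Q)%E]_w F e0 w)%E).
  rewrite fubini_tonelli1 //; apply: ge0_le_integral => //.
  - by move=> w _; exact: sup_offset_ge0.
  - exact: measurable_sup_offset.
  - exact: measurable_fun_fubini_tonelli_F.
  - by move=> w _; exact: sup_offset_le_ghost.
have p2 : 0 < 2 ^+ n :> R by rewrite exprn_gt0.
have Ee (e : {ffun 'I_n -> bool}) : (\int[(Q \x Q)%E]_w F e w = \int[(Q \x Q)%E]_w F e0 w)%E.
  apply: integral_swap_pairs => //; first exact: measurable_sup_pair_offset.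
  exact: sup_pair_offset_ge0.
(* Multiplied by 2^n, the integral becomes the sum of the equal integrals over all swap patterns,
   and the pointwise bound on that sum applies. *)
rewrite -(@lee_pmul2l _ (2 ^+ n)%:E) // ?lte_fin // -EFinM.
have -> : ((2 ^+ n)%:E * \int[(Q \x Q)%E]_w F e0 w =
    \sum_(e : {ffun 'I_n -> bool}) \int[(Q \x Q)%E]_w F e w)%E.
  have -> : (2 ^+ n)%:E = (\sum_(e : {ffun 'I_n -> bool}) 1%:E)%E :> \bar R.
    by rewrite sumEFin sumr_const card_ffun card_bool card_ord natrX.
  rewrite ge0_sume_distrl; last by move=> e _; rewrite lee_fin.
  by apply: eq_bigr => e _; rewrite mul1e Ee.
rewrite -ge0_integral_sum //.
apply: (@le_trans _ _ (\int[(Q \x Q)%E]_w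
    cst (2 ^+ n * (N * expR (lam * (n%:R * (6 * del)))))%:E w)%E).
  apply: ge0_le_integral => //.
  - by move=> w _; apply: sume_ge0.
  - exact: emeasurable_sum.
  - by move=> w _; exact: sup_pair_offset_sign_sum.
rewrite integral_cst // [X in (_ * X)%E](_ : _ = 1%E) ?mule1 //.
rewrite -setXTT; transitivity (Q setT * Q setT)%E; first exact: product_measure1E.
by rewrite !probability_setT mule1.
Qed.

End symmetrization.

Lemma RintegralN d (T : measurableType d) (R : realType)
    (mu : {measure set T -> \bar R}) (g : T -> R) :
  mu.-integrable setT (EFin \o g) -> \int[mu]_x (- g x) = - \int[mu]_x g x.
Proof.
move=> ig; rewrite -[RHS]mulN1r -RintegralZl //.
by apply: eq_Rintegral => x _; rewrite mulN1r.
Qed.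

(* A single nonnegative variable M controls the whole process, both in
   expectation and in probability. *)
Lemma offset_concentration (R : realType) (n : nat) (d : 'I_n -> measure_display)
    (X : forall i : 'I_n, measurableType (d i))
    (dO : measure_display) (Om : measurableType dO)
    (Xv : forall i : 'I_n, {mfun Om >-> X i}) (Q : probability Om R)
    (f : nat -> forall i, X i -> R) (c del N A : R) :
  independent Xv Q ->
  (forall k i, measurable_fun setT (f k i)) ->
  (forall k i x, `|f k i x| <= 1) ->
  0 < c -> c <= 1 ->
  (forall w1 w2 : Om, exists r : seq nat, (size r)%:R <= N /\
    forall k, exists2 k', k' \in r & forall i,
      `|f k i (Xv i w1) - f k' i (Xv i w1)| <= del /\
      `|f k i (Xv i w2) - f k' i (Xv i w2)| <= del) ->
  N * expR (c / 36 * (n%:R * (6 * del))) <= expR A ->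
  exists M : Om -> \bar R, [/\ measurable_fun setT M, (forall w, 0 <= M w)%E,
    (\int[Q]_w M w <= 2%:E)%E &
    forall k w, ((expR (c / 36 *
      (`|\sum_i (f k i (Xv i w) - \int[Q]_v f k i (Xv i v))|
       - 2 * c * \sum_i \int[Q]_v (f k i (Xv i v) ^+ 2)) - A))%:E <= M w)%E].
Proof.
move=> indep mf f1 c0 c1 cover NA.
(* The absolute value is obtained by applying the one-sided bound to [f] and to its opposite, which
   have the same covers and second moments. *)
pose g k i x := - f k i x.
have mg k i : measurable_fun setT (g k i).
  exact: (measurable_funN (@mf k i)).
have g1 k i x : `|g k i x| <= 1 by rewrite normrN.
have coverg w1 w2 : exists r : seq nat, (size r)%:R <= N /\
    forall k, exists2 k', k' \in r & forall i,
      `|g k i (Xv i w1) - g k' i (Xv i w1)| <= del /\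
      `|g k i (Xv i w2) - g k' i (Xv i w2)| <= del.
  have [r [rN rP]] := cover w1 w2; exists r; split=> // k.
  have [k' k'r kk'] := rP k; exists k' => // i.
  have e (u v : R) : `|- u - - v| = `|u - v| by rewrite opprK addrC distrC.
  by rewrite /g !e; exact: kk'.
have [M1 [mM1 M10 I1 M1P]] : exists M1 : Om -> \bar R,
    [/\ measurable_fun setT M1, (forall w, 0 <= M1 w)%E,
    (\int[Q]_w M1 w <= (expR A)%:E)%E &
    forall k w, ((expR (c / 36 * offset_proc Xv Q f c k w))%:E <= M1 w)%E].
  exists (sup_offset Xv Q f c); split; first exact: measurable_sup_offset.
  - exact: sup_offset_ge0.
  - by apply: le_trans (integral_sup_offset indep mf f1 c0 c1 cover) _; rewrite lee_fin.
  - by move=> k w; apply: ereal_sup_ubound; exists k.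
have [M2 [mM2 M20 I2 M2P]] : exists M2 : Om -> \bar R,
    [/\ measurable_fun setT M2, (forall w, 0 <= M2 w)%E,
    (\int[Q]_w M2 w <= (expR A)%:E)%E &
    forall k w, ((expR (c / 36 * offset_proc Xv Q g c k w))%:E <= M2 w)%E].
  exists (sup_offset Xv Q g c); split; first exact: measurable_sup_offset.
  - exact: sup_offset_ge0.
  - by apply: le_trans (integral_sup_offset indep mg g1 c0 c1 coverg) _; rewrite lee_fin.
  - by move=> k w; apply: ereal_sup_ubound; exists k.
have mM12 : measurable_fun setT (fun w => M1 w + M2 w)%E.
  exact: (emeasurable_funD mM1 mM2).
(* Each one-sided supremum has mean at most exp A, so the normalized sum has mean at most 2. *)
exists (fun w => (expR (- A))%:E * (M1 w + M2 w))%E; split.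
- exact: (measurable_funeM _ mM12).
- by move=> w; rewrite mule_ge0 ?adde_ge0 // lee_fin expR_ge0.
- rewrite (ge0_integralZl _ measurableT mM12); last 2 first.
  + by move=> w _; rewrite adde_ge0.
  + by rewrite lee_fin expR_ge0.
  rewrite (ge0_integralD _ measurableT (fun w _ => M10 w) mM1 (fun w _ => M20 w) mM2).
  apply: (@le_trans _ _ ((expR (- A))%:E * ((expR A)%:E + (expR A)%:E))%E).
    by rewrite lee_wpmul2l ?lee_fin ?expR_ge0 // leeD.
  by rewrite -EFinD -EFinM lee_fin mulrDr -expRD addNr expR0.
move=> k w; rewrite addrC expRD EFinM.
rewrite lee_wpmul2l ?lee_fin ?expR_ge0 //.
set s2 := \sum_i \int[Q]_v _.
have e1 : offset_proc Xv Q f c k w =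
    \sum_i (f k i (Xv i w) - \int[Q]_v f k i (Xv i v)) - 2 * c * s2.
  by rewrite /offset_proc sumrB /s2 mulr_sumr.
have e2 : offset_proc Xv Q g c k w =
    - \sum_i (f k i (Xv i w) - \int[Q]_v f k i (Xv i v)) - 2 * c * s2.
  rewrite /offset_proc sumrB /s2 mulr_sumr; congr (_ - _).
    rewrite -sumrN; apply: eq_bigr => i _.
    have -> : \int[Q]_v g k i (Xv i v) = - \int[Q]_v f k i (Xv i v).
      apply: RintegralN; apply: (@bounded_integrable _ _ _ _ _ 1) => [|v]; last exact: f1.
      exact: (measurableT_comp (@mf k i)).
    by rewrite /g opprB opprK addrC.
  by apply: eq_bigr => i _; congr (_ * _); apply: eq_Rintegral => v _; rewrite sqrrN.
have [p|p] := leP 0 (\sum_i (f k i (Xv i w) - \int[Q]_v f k i (Xv i v))).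
  apply: (@le_trans _ _ (M1 w)); last by rewrite leeDl.
  by have := M1P k w; rewrite e1 ger0_norm.
apply: (@le_trans _ _ (M2 w)); last by rewrite leeDr.
by have := M2P k w; rewrite e2 ltr0_norm.
Qed.

(** * Hellinger distance *)

Section hellinger.
Context {R : realType} {n : nat} {d : 'I_n -> measure_display}.
Context {X : forall i : 'I_n, measurableType (d i)}.
Variable mu : forall i : 'I_n, {measure set (X i) -> \bar R}.

Let diff2 i (u v : X i -> R) x := (Num.sqrt (u x) - Num.sqrt (v x)) ^+ 2.

Lemma density_integrableP i (t : X i -> R) : density mu t ->
  (mu i).-integrable setT (EFin \o t).
Proof. by move=> [mt t0 t1]; exact: density_integrable. Qed.

Lemma density_Rintegral i (t : X i -> R) : density mu t -> \int[mu i]_x t x = 1.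
Proof. by move=> [_ _ t1]; rewrite /Rintegral t1. Qed.

Lemma diff2_integrable i (u v : X i -> R) : density mu u -> density mu v ->
  (mu i).-integrable setT (EFin \o diff2 u v).
Proof.
move=> du dv; have [mf u0 _] := du; have [mv v0 _] := dv.
apply: (le_integrable measurableT _ _
  (integrableD measurableT (density_integrableP du) (density_integrableP dv))).
  apply/measurable_EFinP; apply: measurable_funX.
  by apply: measurable_funB; exact: measurable_sqrt.
move=> x _ /=; rewrite lee_fin ger0_norm ?sqr_ge0 //.
rewrite (le_trans _ (ler_norm _)) // /diff2.
have := sqr_sqrtr (u0 x); have := sqr_sqrtr (v0 x).
have := sqrtr_ge0 (u x); have := sqrtr_ge0 (v x); nra.
Qed.

Lemma hell2_ge0 i (u v : X i -> R) : 0 <= hell2 mu u v.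
Proof. by rewrite mulr_ge0 ?invr_ge0 // Rintegral_ge0 // => x _; exact: sqr_ge0. Qed.

Lemma h2_ge0 t u : 0 <= h2 mu t u.
Proof. by apply: sumr_ge0 => i _; exact: hell2_ge0. Qed.

Lemma h_sqr t u : h mu t u ^+ 2 = h2 mu t u.
Proof. by rewrite sqr_sqrtr // h2_ge0. Qed.

(** It comes from the pointwise (a - b)^2 <= 2 (a - e)^2 + 2 (e - b)^2, so the triangle inequality
    for [h] itself is avoided. *)
Lemma h2_triangle t u v : L0 mu t -> L0 mu u -> L0 mu v ->
  h2 mu t v <= 2 * h2 mu t u + 2 * h2 mu u v.
Proof.
move=> Lt Lu Lv; rewrite /h2 !mulr_sumr -big_split; apply: ler_sum => i _ /=.
have i1 := diff2_integrable (Lt i) (Lu i); have i2 := diff2_integrable (Lu i) (Lv i).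
have z1 : (mu i).-integrable setT (EFin \o (fun x => 2 * diff2 (t i) (u i) x)).
  exact: (integrableZl measurableT 2 i1).
have z2 : (mu i).-integrable setT (EFin \o (fun x => 2 * diff2 (u i) (v i) x)).
  exact: (integrableZl measurableT 2 i2).
have : \int[mu i]_x diff2 (t i) (v i) x <=
    \int[mu i]_x (2 * diff2 (t i) (u i) x + 2 * diff2 (u i) (v i) x).
  apply: le_Rintegral => //.
  - exact: diff2_integrable.
  - exact: (integrableD measurableT z1 z2).
  move=> x _; rewrite /diff2.
  set a := Num.sqrt _; set b := Num.sqrt _; set e := Num.sqrt (u i x).
  by have := sqr_ge0 (a + b - 2 * e); lra.
rewrite RintegralD // !RintegralZl // /hell2 -!/(diff2 _ _ _); lra.
Qed.

Section expectation.
Context {dO : measure_display} {Om : measurableType dO}.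
Variables (Xv : forall i : 'I_n, {mfun Om >-> X i}) (Q : probability Om R).

Lemma measurable_density_phi i (t u : X i -> R) : density mu t -> density mu u ->
  measurable_fun setT (fun x => phi (u x) (t x)).
Proof. by move=> [mt _ _] [mU _ _]; exact: measurable_phi. Qed.

Lemma phi_second_moment_le i (s t u : X i -> R) :
  density mu s -> density mu t -> density mu u ->
  has_density mu Xv Q s ->
  \int[Q]_w (phi (u (Xv i w)) (t (Xv i w)) ^+ 2) <=
  12 * hell2 mu s t + 8 * hell2 mu s u.
Proof.
move=> ds dt du hs.
have [ms s0 s1] := ds; have [_ t0 _] := dt; have [_ u0 _] := du.
have mphi : measurable_fun setT (fun x => phi (u x) (t x) ^+ 2).
  by apply: measurable_funX; exact: measurable_density_phi.
have phi1 x : `|phi (u x) (t x) ^+ 2| <= 1 by rewrite normrX expr_le1 // phi_le1.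
rewrite (Rintegral_has_density s0 ms s1 hs mphi phi1).
have z1 : (mu i).-integrable setT (EFin \o (fun x => 6 * diff2 s t x)).
  exact: (integrableZl measurableT 6 (diff2_integrable ds dt)).
have z2 : (mu i).-integrable setT (EFin \o (fun x => 4 * diff2 s u x)).
  exact: (integrableZl measurableT 4 (diff2_integrable ds du)).
apply: (@le_trans _ _ (\int[mu i]_x (6 * diff2 s t x + 4 * diff2 s u x))).
  apply: le_Rintegral => //.
  - exact: (bounded_density_integrable s0 ms s1 mphi phi1).
  - exact: (integrableD measurableT z1 z2).
  by move=> x _; exact: phi_second_moment.
rewrite RintegralD // !RintegralZl ?diff2_integrable // /hell2 -!/(diff2 _ _ _); lra.
Qed.

(** Integrating the pointwise bound doubles its coefficients, as [hell2] carries a factor 1/2: this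
    is the origin of [c2] = 1 + 1 / sqrt 2 and of 8 [c0] = 1 - 1 / sqrt 2. *)
Lemma mean_stat_le i (s t u : X i -> R) :
  density mu s -> density mu t -> density mu u ->
  has_density mu Xv Q s ->
  2^-1 * (affinity mu u (fun x => (t x + u x) / 2) -
          affinity mu t (fun x => (t x + u x) / 2))
  + (Num.sqrt 2)^-1 * \int[Q]_w phi (u (Xv i w)) (t (Xv i w)) <=
  c2 * hell2 mu s t - 8 * c0 * hell2 mu s u.
Proof.
move=> ds dt du hs.
have [ms s0 s1] := ds; have [mt t0 _] := dt; have [mU u0 _] := du.
have mphi := measurable_density_phi dt du.
have phi1 x : `|phi (u x) (t x)| <= 1 by rewrite phi_le1.
rewrite (Rintegral_has_density s0 ms s1 hs mphi phi1).
set r := fun x => (t x + u x) / 2.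
have aff (v : X i -> R) : measurable_fun setT v -> (forall x, 0 <= v x) ->
    (forall x, v x <= t x + u x) ->
    (mu i).-integrable setT (EFin \o (fun x => Num.sqrt (v x * r x))).
  move=> mv v0 vtu; apply: (le_integrable measurableT _ _
    (integrableD measurableT (density_integrableP dt) (density_integrableP du))).
    apply/measurable_EFinP; apply: measurable_sqrt; apply: measurable_funM => //.
    by apply: measurable_funM => //; exact: measurable_funD.
  move=> x _ /=; rewrite lee_fin ger0_norm ?sqrtr_ge0 //.
  have tu0 : 0 <= t x + u x by rewrite addr_ge0.
  rewrite (le_trans _ (ler_norm _)) // -[leRHS]ger0_norm // -sqrtr_sqr.
  rewrite ler_wsqrtr // expr2 ler_pM // /r.
  - by rewrite divr_ge0.
  - by lra.
have iu : (mu i).-integrable setT (EFin \o (fun x => Num.sqrt (u x * r x))).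
  by apply: aff => // x; rewrite lerDr.
have it : (mu i).-integrable setT (EFin \o (fun x => Num.sqrt (t x * r x))).
  by apply: aff => // x; rewrite lerDl.
have ip := bounded_density_integrable s0 ms s1 mphi phi1.
have iut := integrableB measurableT iu it.
have iut2 : (mu i).-integrable setT (EFin \o (fun x =>
    2^-1 * (Num.sqrt (u x * r x) - Num.sqrt (t x * r x)))).
  exact: (integrableZl measurableT (2^-1) iut).
have ip2 : (mu i).-integrable setT (EFin \o (fun x =>
    (Num.sqrt 2)^-1 * (phi (u x) (t x) * s x))).
  exact: (integrableZl measurableT _ ip).
have -> : 2^-1 * (affinity mu u r - affinity mu t r)
    + (Num.sqrt 2)^-1 * \int[mu i]_x (phi (u x) (t x) * s x) =
    \int[mu i]_x (2^-1 * (Num.sqrt (u x * r x) - Num.sqrt (t x * r x))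
      + (Num.sqrt 2)^-1 * (phi (u x) (t x) * s x)).
  by rewrite RintegralD // !RintegralZl // RintegralB.
pose a : R := 2^-1 * (1 + (Num.sqrt 2)^-1).
pose b : R := 2^-1 * (1 - (Num.sqrt 2)^-1).
have za : (mu i).-integrable setT (EFin \o (fun x => a * diff2 s t x)).
  exact: (integrableZl measurableT a (diff2_integrable ds dt)).
have zb : (mu i).-integrable setT (EFin \o (fun x => b * diff2 s u x)).
  exact: (integrableZl measurableT b (diff2_integrable ds du)).
have zab : (mu i).-integrable setT
    (EFin \o (fun x => a * diff2 s t x - b * diff2 s u x)).
  exact: (integrableB measurableT za zb).
have zut : (mu i).-integrable setT (EFin \o (fun x => u x - t x)).
  exact: (integrableB measurableT (density_integrableP du) (density_integrableP dt)).
have zut2 : (mu i).-integrable setT (EFin \o (fun x => 2^-1 * (u x - t x))).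
  exact: (integrableZl measurableT _ zut).
apply: (@le_trans _ _ (\int[mu i]_x
    (a * diff2 s t x - b * diff2 s u x + 2^-1 * (u x - t x)))).
  apply: le_Rintegral => //.
  - exact: (integrableD measurableT iut2 ip2).
  - exact: (integrableD measurableT zab zut2).
  by move=> x _; exact: mean_stat_pointwise.
rewrite RintegralD // RintegralB // RintegralZl ?diff2_integrable //.
rewrite RintegralZl ?diff2_integrable // RintegralZl // RintegralB ?density_integrableP //.
(* The remaining term (u - t) / 2 integrates to zero because both densities have mass one. *)
rewrite (density_Rintegral dt) (density_Rintegral du) subrr mulr0 addr0 /hell2 /diff2 /c2 /c0 /a /b.
set It := \int[_]_x _; set Iu := \int[_]_x _; set q := (Num.sqrt 2)^-1.
by rewrite le_eqVlt; apply/orP; left; apply/eqP; field.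
Qed.

End expectation.
End hellinger.

(** * Concentration for VC-subgraph models *)

(** Repetitions are allowed: indices that are not the code of an element of [S] return [t0], so
    finite sets are included. *)
Lemma countable_range (T : Type) (S : set T) (t0 : T) : countable S -> S t0 ->
  exists g : nat -> T, (forall k, S (g k)) /\ (forall t, S t -> exists k, g k = t).
Proof.
move=> /countable_injP[f finj] St0.
have /choice[g gP] k : exists t, S t /\ forall u, S u -> f u = k -> t = u.
  have [[u [Su fu]]|no] := pselect (exists u, S u /\ f u = k).
    exists u; split=> // v Sv fv; apply: finj; rewrite ?inE //.
    by rewrite fu fv.
  by exists t0; split=> // u Su fu; exfalso; apply: no; exists u.
exists g; split=> [k|t St]; first by have [] := gP k.
by exists (f t); have [_] := gP (f t); exact.
Qed.

(** The empty set is shattered by any nonempty class. The resulting V >= 1 lets the rate absorb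
    absolute constants. *)
Lemma vc_subgraph_index_gt0 (R : realType) (Xi : Type) (G : set (Xi -> R)) V t :
  vc_subgraph G V -> G t -> (0 < V)%N.
Proof.
move=> [noV _] Gt; rewrite lt0n; apply/eqP => V0; subst V.
apply: (noV set0); first by rewrite II0.
move=> B; rewrite subset0 => ->; exists (subgraph t); first by exists t.
by rewrite set0I.
Qed.

(** The two forms of the model are treated at once: the covering argument only needs t i x to be the
    value of a member of one VC-subgraph class at a point that does not depend on t. *)
Lemma vc_model_pullback (R : realType) (n : nat) (d : 'I_n -> measure_display)
    (X : forall i : 'I_n, measurableType (d i))
    (Sbar : set (forall i, X i -> R)) (V : nat) :
  vc_model Sbar V \/ diagonal_vc_model Sbar V ->
  exists (Xi : Type) (G : set (Xi -> R)) (iota : forall i, X i -> Xi),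
    vc_subgraph G V /\
    forall t, Sbar t -> exists2 u, G u & forall i x, t i x = u (iota i x).
Proof.
case=> [vcS | [T [eX [Th [-> vcT]]]]].
  exists {i & X i}, [set joint_fun t | t in Sbar], (fun i x => existT _ i x).
  by split=> // t St; exists (joint_fun t) => //; exists t.
exists T, Th, (fun i x => cast (eX i) x); split=> // _ [u Tu <-].
by exists u.
Qed.

Section constants.
Context {R : realType}.

Lemma sqrt2_itv : (Num.sqrt 2)^-1 <= 3 / 4 :> R /\ 2 / 3 <= (Num.sqrt 2)^-1 :> R.
Proof.
have k0 : 0 < Num.sqrt 2 :> R by rewrite sqrtr_gt0.
have k2 : Num.sqrt 2 ^+ 2 = 2 :> R by rewrite sqr_sqrtr.
by split; [rewrite -[leLHS]mul1r ler_pdivrMr // | rewrite -[leRHS]mul1r ler_pdivlMr //]; nra.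
Qed.

Lemma c0_itv : 1 / 32 <= c0 :> R /\ c0 <= 1 / 24 :> R.
Proof. by have := sqrt2_itv; rewrite /c0 => -[? ?]; split; lra. Qed.

Lemma c2_itv : 1 <= c2 :> R /\ c2 <= 7 / 4 :> R.
Proof. by have := sqrt2_itv; rewrite /c2 => -[? ?]; split; lra. Qed.

(* The exponent c / 36 of [offset_diff_exp] for c = c0 / 48, the value for which
   the offset 2c E phi^2 is at most (c0 / 2) (h^2(s, t) + h^2(s, sbar)), by
   [phi_second_moment_le]. *)
Definition conc_rate : R := c0 / 48 / 36.

Lemma conc_rate_gt0 : 0 < conc_rate.
Proof. by have := c0_itv; rewrite /conc_rate => -[? ?]; lra. Qed.

Lemma vc_rate_ge1 (n V : nat) : (0 < V)%N -> 1 <= vc_rate n V :> R.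
Proof. by move=> V0; apply: le_trans (vc_rate_ge R n V); rewrite ler1n. Qed.

End constants.

Section deviation.
Context {R : realType} {n : nat} {d : 'I_n -> measure_display}.
Context {X : forall i : 'I_n, measurableType (d i)}.
Variable mu : forall i : 'I_n, {measure set (X i) -> \bar R}.
Context {dO : measure_display} {Om : measurableType dO}.
Variable Xv : forall i : 'I_n, {mfun Om >-> X i}.
Variable P : (forall i, X i -> R) -> probability Om R.
Implicit Types s t sbar : forall i, X i -> R.

Lemma psi_phi t u : L0 mu t -> L0 mu u -> forall i x,
  psi (sqrte (quot (u i x) (t i x))) = phi (u i x) (t i x).
Proof.
by move=> Lt Lu i x; have [_ t0 _] := Lt i; have [_ u0 _] := Lu i; rewrite psi_quotE.
Qed.

Lemma ZstatE s sbar t w : L0 mu sbar -> L0 mu t ->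
  Zstat Xv P s sbar t w = \sum_i (phi (t i (Xv i w)) (sbar i (Xv i w))
     - \int[P s]_v phi (t i (Xv i v)) (sbar i (Xv i v))).
Proof.
move=> Lb Lt; apply: eq_bigr => i _; rewrite (psi_phi Lb Lt); congr (_ - _).
by apply: eq_Rintegral => v _; rewrite (psi_phi Lb Lt).
Qed.

Lemma measurable_Zstat s sbar t : L0 mu sbar -> L0 mu t ->
  measurable_fun setT (Zstat Xv P s sbar t).
Proof.
move=> Lb Lt; have -> : Zstat Xv P s sbar t =
    fun w => \sum_i (phi (t i (Xv i w)) (sbar i (Xv i w))
      - \int[P s]_v phi (t i (Xv i v)) (sbar i (Xv i v))).
  by apply/funext => w; exact: ZstatE.
apply: measurable_sum => i; apply: measurable_funB => //.
exact: (measurableT_comp (measurable_density_phi (Lb i) (Lt i)) (measurable_funPT (Xv i))).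
Qed.

Lemma phi_cover (Sbar : set (forall i, X i -> R)) (V : nat) (sbar : forall i, X i -> R)
    (g : nat -> forall i, X i -> R) :
  (0 < n)%N -> Sbar `<=` L0 mu -> vc_model Sbar V \/ diagonal_vc_model Sbar V ->
  L0 mu sbar -> (forall k, Sbar (g k)) ->
  forall w1 w2 : Om, exists r : seq nat, (size r)%:R <= expR (8 * vc_rate n V : R) /\
    forall k, exists2 k', k' \in r & forall i,
      `|phi (g k i (Xv i w1)) (sbar i (Xv i w1))
        - phi (g k' i (Xv i w1)) (sbar i (Xv i w1))| <= (n %/ V).+1%:R^-1 /\
      `|phi (g k i (Xv i w2)) (sbar i (Xv i w2))
        - phi (g k' i (Xv i w2)) (sbar i (Xv i w2))| <= (n %/ V).+1%:R^-1.
Proof.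
move=> n0 SL vcS Lb Sg w1 w2.
have [Xi [G [iota [vcG GS]]]] := vc_model_pullback vcS.
have /choice[u uP] k : exists u, G u /\ forall i x, g k i x = u (iota i x).
  by have [u Gu ue] := GS _ (Sg k); exists u.
have V0 := vc_subgraph_index_gt0 vcG (uP 0%N).1.
pose pt (i : 'I_n) (b : bool) := Xv i (if b then w1 else w2).
pose p (j : 'I_n * bool) := iota j.1 (pt j.1 j.2).
(* The cut at 0 makes the map monotone and bounded on all of R, as the covering lemma demands; it
   does not affect densities. *)
pose ph (j : 'I_n * bool) (v : R) := phi (Num.max v 0) (sbar j.1 (pt j.1 j.2)).
have m0 (v : R) : 0 <= Num.max v 0 by rewrite le_max lexx orbT.
have b0 i x : 0 <= sbar i x by have [_ h _] := Lb i.
have [|j v|r [rN rP]] := @vc_subgraph_cover R Xi G V u _ p ph (n %/ V).+1 isT vcG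
    (fun k => (uP k).1).
- move=> j v v' vv'; apply: phi_mono => //.
  by rewrite ge_max !le_max vv' lexx orbT.
- exact: phi_le1.
exists r; split.
  apply: cover_size_le => // x x0 x1; have := rN x x0 x1.
  by rewrite card_prod card_ord card_bool.
move=> k; have [k' k'r kk'] := rP k; exists k' => // i.
have ge k2 i' x : Num.max (u k2 (iota i' x)) 0 = g k2 i' x.
  rewrite -(uP k2).2; apply: max_l.
  by have [_ h _] := SL _ (Sg k2) i'.
by split; [have := kk' (i, true)|have := kk' (i, false)]; rewrite /ph /p /= !ge.
Qed.

Lemma Zstat_concentration (Sbar S : set (forall i, X i -> R)) (V : nat) s sbar :
  (0 < n)%N -> experiment mu Xv P -> Sbar `<=` L0 mu ->
  vc_model Sbar V \/ diagonal_vc_model Sbar V ->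
  S `<=` Sbar -> countable S -> S !=set0 -> L0 mu s -> L0 mu sbar ->
  exists M : Om -> \bar R, [/\ measurable_fun setT M, (forall w, 0 <= M w)%E,
    (\int[P s]_w M w <= 2%:E)%E &
    forall t w, S t -> ((expR (conc_rate *
      (`|Zstat Xv P s sbar t w| - c0 / 2 * (h2 mu s t + h2 mu s sbar))
       - 14 * vc_rate n V))%:E <= M w)%E].
Proof.
move=> n0 expP SL vcS SS cS [t0 St0] Ls Lb.
have [g [Sg gS]] := countable_range cS St0.
have Lg k : L0 mu (g k) by exact/SL/SS.
have Sbg k : Sbar (g k) by exact: SS.
have [indep dens] := expP s Ls.
pose f k i x := phi (g k i x) (sbar i x).
have [c0l c0u] := @c0_itv R.
have [Xi [G [iota [vcG GS]]]] := vc_model_pullback vcS.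
have [u0 Gu0 _] := GS _ (Sbg 0%N).
have V0 := vc_subgraph_index_gt0 vcG Gu0.
have mf k i : measurable_fun setT (f k i).
  exact: measurable_density_phi (Lb i) (Lg k i).
have f1 k i x : `|f k i x| <= 1.
  by have [_ h1 _] := Lg k i; have [_ h2 _] := Lb i; exact: phi_le1.
have cp : 0 < c0 / 48 :> R by lra.
have c1 : c0 / 48 <= 1 :> R by lra.
have L0 : 0 < (n %/ V).+1%:R :> R by rewrite ltr0n.
have [|M [mM M0 iM MP]] := offset_concentration (A := 14 * vc_rate n V) indep mf f1 cp c1
    (phi_cover n0 SL vcS Lb Sbg).
  (* The constant 14 is 8 + 6: the logarithm of the cover size, and the discretization error n * 6 /
     L <= 6 V. *)
  rewrite -expRD ler_expR.
  have nL : n%:R * (n %/ V).+1%:R^-1 <= V%:R :> R.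
    by rewrite ler_pdivrMr // -natrM ler_nat mulnC ltnW // ltn_ceil.
  have := vc_rate_ge R n V; have : 0 <= V%:R :> R by rewrite ler0n.
  have : 0 <= n%:R * (n %/ V).+1%:R^-1 :> R by rewrite divr_ge0 ?ler0n.
  rewrite (mulrCA n%:R 6); move: nL; set q := n%:R * _ => nL q0 VR0 Vr.
  have : c0 / 48 / 36 * (6 * q) <= 6 * q by rewrite ler_piMl ?mulr_ge0 //; lra.
  lra.
exists M; split=> // t w /gS[k <-]; apply: le_trans (MP k w).
rewrite lee_fin ler_expR lerD2r ler_wpM2l ?(ltW conc_rate_gt0) // lerB //.
  by rewrite (ZstatE _ _ Lb (Lg k)).
(* The coefficients become c0 / 2 for h^2(s, sbar) and c0 / 3 for h^2(s, t); the second is enlarged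
   to c0 / 2. *)
apply: (@le_trans _ _ (2 * (c0 / 48) *
    \sum_i (12 * hell2 mu (s i) (sbar i) + 8 * hell2 mu (s i) (g k i)))).
  apply: ler_wpM2l; first by lra.
  apply: ler_sum => i _.
  exact: (phi_second_moment_le (Ls i) (Lb i) (Lg k i) (dens i)).
have e v (a : R) : \sum_i a * hell2 mu (s i) (v i) = a * h2 mu s v.
  by rewrite /h2 mulr_sumr.
rewrite big_split /= !e.
have : 0 <= c0 * h2 mu s (g k) by rewrite mulr_ge0 ?h2_ge0 //; lra.
lra.
Qed.

End deviation.

(** * Uniform dimension *)

Section dimension.
Context {R : realType} {n : nat} {d : 'I_n -> measure_display}.
Context {X : forall i : 'I_n, measurableType (d i)}.
Variable mu : forall i : 'I_n, {measure set (X i) -> \bar R}.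
Context {dO : measure_display} {Om : measurableType dO}.
Variable Xv : forall i : 'I_n, {mfun Om >-> X i}.
Variable P : (forall i, X i -> R) -> probability Om R.
Implicit Types s t sbar : forall i, X i -> R.

Lemma sup0_le (A : set (\bar R)) (b : \bar R) :
  (0 <= b)%E -> (forall x, A x -> (x <= b)%E) -> (Defs.sup0 A <= b)%E.
Proof.
by move=> b0 Ab; rewrite /Defs.sup0; case: ifP => // _; exact: ge_ereal_sup.
Qed.

Lemma measurable_sup0_Zstat (S : set (forall i, X i -> R)) s sbar y :
  countable S -> S !=set0 -> S `<=` L0 mu -> L0 mu sbar ->
  measurable_fun setT (fun v =>
    Defs.sup0 [set `|Zstat Xv P s sbar t v|%:E | t in Bset mu S s sbar y]).
Proof.
move=> cS [t0 St0] SL Lb; have [g [Sg gS]] := countable_range cS St0.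
(* Membership in the ball does not depend on [v]. Indices outside it get the value 0, which changes
   nothing because the other values are nonnegative and [sup0] is 0 on the empty set. *)
pose F k v : \bar R := if `[<Bset mu S s sbar y (g k)>]
  then `|Zstat Xv P s sbar (g k) v|%:E else 0%E.
have F0 k v : (0 <= F k v)%E by rewrite /F; case: ifP => _ //; rewrite lee_fin.
rewrite (_ : (fun v => _) = (fun v => ereal_sup (range (fun k => F k v)))).
  apply: measurable_ereal_sup_range => k; rewrite /F.
  case: (asboolP (Bset mu S s sbar y (g k))) => _ //.
  apply/measurable_EFinP; apply: measurableT_comp => //.
  exact: (measurable_Zstat _ _ _ Lb (SL _ (Sg k))).
apply/funext => v; apply/eqP; rewrite eq_le; apply/andP; split.
  apply: sup0_le.
    by apply: (le_trans (F0 0%N v)); apply: ereal_sup_ubound; exists 0%N.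
  move=> _ [t Bt <-]; have [k gk] := gS t Bt.1.
  apply: ereal_sup_ubound; exists k => //; rewrite /F gk.
  by case: asboolP.
apply: ge_ereal_sup => _ [k _ <-]; rewrite /F; case: asboolP => Bk.
  rewrite /Defs.sup0; case: eqP => [e|_].
    exfalso; have : set0 `|Zstat Xv P s sbar (g k) v|%:E by rewrite -e; exists (g k).
    by [].
  by apply: ereal_sup_ubound; exists (g k).
rewrite /Defs.sup0; case: eqP => [//|/eqP/set0P[_ [t Bt _]]].
apply: (@le_trans _ _ `|Zstat Xv P s sbar t v|%:E); first by rewrite lee_fin.
by apply: ereal_sup_ubound; exists t.
Qed.

(** By 1 + z <= exp z, an exponential control becomes an affine one, which can be integrated; [m]
    may be infinite. *)
Lemma exp_le_linear (x l A b : R) (m : \bar R) : 0 < l -> (0 <= m)%E ->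
  ((expR (l * (x - b) - A))%:E <= m)%E ->
  (x%:E <= (b + A / l)%:E + (l^-1)%:E * m)%E.
Proof.
move=> l0; case: m => [m| |] //; last first.
  by move=> _ _; rewrite mulry gtr0_sg ?invr_gt0 // mul1e addey // leey.
rewrite !lee_fin => m0 em; change (x <= b + A / l + l^-1 * m).
have := expR_ge1Dx (l * (x - b) - A) => h.
have {}em : l * (x - b) - A <= m by lra.
have -> : b + A / l + l^-1 * m = b + (A + m) / l by rewrite mulrDl; ring.
by rewrite -lerBlDl ler_pdivlMr // mulrC; lra.
Qed.

(** On the ball the offset is at most (c0 / 2) y^2. As the dimension compares [wS] with c0 y^2, the
    other half then forces y^2 to be of the order of the rate. *)
Lemma wS_le (Sbar S : set (forall i, X i -> R)) (V : nat) s sbar y :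
  (0 < n)%N -> experiment mu Xv P -> Sbar `<=` L0 mu ->
  vc_model Sbar V \/ diagonal_vc_model Sbar V ->
  S `<=` Sbar -> countable S -> S !=set0 -> L0 mu s -> L0 mu sbar ->
  (wS mu Xv P S s sbar y <=
   (c0 / 2 * y ^+ 2 + (14 * vc_rate n V + 2) / conc_rate)%:E)%E.
Proof.
move=> n0 expP SL vcS SS cS S0 Ls Lb.
have [M [mM M0 iM MP]] := Zstat_concentration n0 expP SL vcS SS cS S0 Ls Lb.
have k0 := @conc_rate_gt0 R.
have [c0l c0u] := @c0_itv R.
have r0 : 0 <= vc_rate n V :> R by apply: le_trans (vc_rate_ge R n V).
pose a := c0 / 2 * y ^+ 2 + (14 * vc_rate n V) / conc_rate.
have a0 : 0 <= a.
  have h1 : 0 <= c0 / 2 * y ^+ 2 by apply: mulr_ge0; [lra | exact: sqr_ge0].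
  have h2 : 0 <= 14 * vc_rate n V / conc_rate :> R.
    by apply: divr_ge0; [lra | exact: ltW].
  by rewrite addr_ge0.
have m2 : measurable_fun setT (fun w => (conc_rate^-1)%:E * M w)%E.
  exact: (measurable_funeM _ mM).
have p2 w : (0 <= (conc_rate^-1)%:E * M w)%E.
  by apply: mule_ge0; rewrite ?lee_fin ?invr_ge0 ?(ltW k0).
have m3 : measurable_fun setT (fun w => a%:E + (conc_rate^-1)%:E * M w)%E.
  by apply: emeasurable_funD.
apply: (@le_trans _ _ (\int[P s]_w (a%:E + (conc_rate^-1)%:E * M w))%E).
  apply: ge0_le_integral => //.
  - move=> w _; rewrite /Defs.sup0; case: eqP => // /eqP/set0P[_ [t Bt _]].
    apply: (@le_trans _ _ `|Zstat Xv P s sbar t w|%:E); first by rewrite lee_fin.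
    by apply: ereal_sup_ubound; exists t.
  - apply: measurable_sup0_Zstat => //; exact: subset_trans SL.
  move=> w _; apply: sup0_le; first by apply: adde_ge0; rewrite ?lee_fin.
  move=> _ [t [St Bt] <-]; apply: exp_le_linear => //.
  apply: le_trans (MP t w St); rewrite lee_fin ler_expR lerD2r.
  rewrite ler_wpM2l ?(ltW k0) // lerB // ler_wpM2l //; lra.
rewrite ge0_integralD //.
rewrite (ge0_integralZl _ measurableT mM) //; last by rewrite lee_fin invr_ge0 ltW.
have -> : (\int[P s]_w a%:E = a%:E)%E.
  transitivity (a%:E * P s setT)%E; first exact: integral_cst.
  by rewrite probability_setT mule1.
apply: (@le_trans _ _ (a%:E + (conc_rate^-1)%:E * 2%:E)%E).
  by rewrite leeD2l // lee_wpmul2l // lee_fin invr_ge0 ltW.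
rewrite -EFinM -EFinD lee_fin /a le_eqVlt; apply/orP; left; apply/eqP.
by rewrite mulrDl; ring.
Qed.

(** Here 32 = 2 (14 + 2), the rate being at least 1, and the final 1 covers the lower cut-off of
    [DS] at 1. *)
Definition dim_const : R := 32 / (conc_rate * c0) + 1.

Lemma Dbar_le (Sbar S : set (forall i, X i -> R)) (V : nat) :
  (0 < n)%N -> (0 < V)%N -> experiment mu Xv P -> Sbar `<=` L0 mu ->
  vc_model Sbar V \/ diagonal_vc_model Sbar V ->
  S `<=` Sbar -> countable S -> S !=set0 ->
  (Dbar mu Xv P S <= (dim_const * vc_rate n V)%:E)%E.
Proof.
move=> n0 V0 expP SL vcS SS cS S0.
have k0 := @conc_rate_gt0 R.
have [c0l c0u] := @c0_itv R.
have c0p : 0 < c0 :> R by lra.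
have r1 := @vc_rate_ge1 R n V V0.
set r := vc_rate n V in r1 *.
have kc : 0 < conc_rate * c0 :> R by rewrite mulr_gt0.
have dc1 : 1 <= dim_const.
  by rewrite /dim_const lerDr divr_ge0 // ltW.
have dr1 : 1 <= dim_const * r by rewrite -[leLHS]mulr1 ler_pM.
apply: sup0_le; first by rewrite lee_fin (le_trans ler01).
move=> _ [s [sbar [Ls Lb ->]]]; rewrite /DS ge_max; apply/andP; split; last first.
  by rewrite lee_fin.
have dr0 : 0 <= dim_const * r by rewrite (le_trans ler01).
have yb : (ybar mu Xv P S s sbar <= (Num.sqrt (dim_const * r))%:E)%E.
  apply: sup0_le; first by rewrite lee_fin sqrtr_ge0.
  move=> _ [y [y0 wy] <-]; rewrite lee_fin.
  rewrite -[y]ger0_norm // -sqrtr_sqr ler_wsqrtr //.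
  have := lt_le_trans wy (wS_le y n0 expP SL vcS SS cS S0 Ls Lb).
  rewrite lte_fin -/r => h.
  have {}h : conc_rate * c0 * y ^+ 2 <= 2 * (14 * r + 2).
    have : c0 / 2 * y ^+ 2 < (14 * r + 2) / conc_rate by lra.
    by rewrite ltr_pdivlMr //; lra.
  have : y ^+ 2 <= 32 * r / (conc_rate * c0).
    by rewrite ler_pdivlMr // mulrC; lra.
  have -> : dim_const * r = 32 * r / (conc_rate * c0) + r.
    by rewrite /dim_const mulrDl mul1r mulrAC.
  lra.
have yb0 : (0 <= ybar mu Xv P S s sbar)%E.
  rewrite /ybar /Defs.sup0; case: eqP => // /eqP/set0P[_ [y [y0 wy] _]].
  by apply: (@le_trans _ _ y%:E); rewrite ?lee_fin //; apply: ereal_sup_ubound; exists y.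
rewrite -(sqr_sqrtr dr0).
by rewrite EFin_expe lee_sqr // lee_fin sqrtr_ge0.
Qed.

(** [S] itself is a candidate in the infimum, and density makes its approximation term vanish. *)
Lemma uniform_dim_le (Sbar S : set (forall i, X i -> R)) :
  Sbar `<=` L0 mu -> Sbar !=set0 -> countable S -> identifiable mu S ->
  dense_in mu S Sbar ->
  (uniform_dim mu Xv P Sbar <= c2%:E * Dbar mu Xv P S)%E.
Proof.
move=> SL [t0 St0] cS idS [SS SD]; apply: ereal_inf_lbound.
exists S; first by split => //; exact: subset_trans SL.
rewrite (_ : [set (hset mu u S ^+ 2)%E | u in Sbar] = [set 0%E]); last first.
  apply/seteqP; split=> [_ [u Su <-]|_ ->].
    by have [_ ->] := SD _ Su; rewrite expe2 mule0.
  by exists t0 => //; have [_ ->] := SD _ St0; rewrite expe2 mule0.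
rewrite /Defs.sup0; case: eqP => [/seteqP[/(_ 0%E erefl)]//|_].
by rewrite ereal_sup1 mule0 add0e.
Qed.

End dimension.

(** * Risk of rho-estimators *)

Section rho_estimation.
Context {R : realType} {n : nat} {d : 'I_n -> measure_display}.
Context {X : forall i : 'I_n, measurableType (d i)}.
Variable mu : forall i : 'I_n, {measure set (X i) -> \bar R}.
Context {dO : measure_display} {Om : measurableType dO}.
Variable Xv : forall i : 'I_n, {mfun Om >-> X i}.
Variable P : (forall i, X i -> R) -> probability Om R.
Implicit Types s t u sbar : forall i, X i -> R.

Lemma h2C t u : h2 mu t u = h2 mu u t.
Proof.
apply: eq_bigr => i _; congr (_ * _); apply: eq_Rintegral => x _.
by rewrite -[RHS]sqrrN opprB.
Qed.

Lemma TstatC x t u : L0 mu t -> L0 mu u -> Tstat mu x u t = - Tstat mu x t u.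
Proof.
move=> Lt Lu; rewrite /Tstat opprD -!mulrN -!sumrN; congr (_ * _ + _ * _).
  apply: eq_bigr => i _; rewrite opprB.
  have -> : (fun y => (u i y + t i y) / 2) = (fun y => (t i y + u i y) / 2).
    by apply/funext => y; rewrite addrC.
  by [].
by apply: eq_bigr => i _; rewrite (psi_phi Lt Lu) (psi_phi Lu Lt) phiC.
Qed.

(** The statistic is its mean plus [Zstat] / sqrt 2; the factor 1 / sqrt 2 is simply bounded by
    1. *)
Lemma Tstat_le s t u w : experiment mu Xv P -> L0 mu s -> L0 mu t -> L0 mu u ->
  Tstat mu (sample Xv w) t u <=
  c2 * h2 mu s t - 8 * c0 * h2 mu s u + `|Zstat Xv P s t u w|.
Proof.
move=> expP Ls Lt Lu; have [_ dens] := expP s Ls.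
have [k1 k23] := @sqrt2_itv R; have k0 : 0 < (Num.sqrt 2)^-1 :> R by lra.
have ZE := ZstatE Xv P s w Lt Lu; set Z := Zstat _ _ _ _ _ _ in ZE *.
pose m i := \int[P s]_v phi (u i (Xv i v)) (t i (Xv i v)).
have mean := fun i => mean_stat_le (Ls i) (Lt i) (Lu i) (dens i).
have -> : Tstat mu (sample Xv w) t u =
    \sum_i (2^-1 * (affinity mu (u i) (fun x => (t i x + u i x) / 2) -
          affinity mu (t i) (fun x => (t i x + u i x) / 2))
      + (Num.sqrt 2)^-1 * m i) + (Num.sqrt 2)^-1 * Z.
  rewrite big_split /= -!mulr_sumr -addrA -mulrDr ZE -big_split /=.
  rewrite /Tstat; congr (_ + _ * _); apply: eq_bigr => i _.
  by rewrite (psi_phi Lt Lu) addrC subrK.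
apply: lerD; last first.
  apply: le_trans (ler_norm _) _; rewrite normrM (ger0_norm (ltW k0)).
  by rewrite ler_piMl //; lra.
apply: le_trans (ler_sum _ (fun i _ => mean i)) _.
by rewrite sumrB /h2 !mulr_sumr.
Qed.

Lemma hset_attained t (S : set (forall i, X i -> R)) (e : R) :
  (hset mu t S < e%:E)%E -> exists2 u, S u & h mu t u < e.
Proof.
by move=> /ereal_inf_lt[_ [u Su <-]]; rewrite lte_fin => ?; exists u.
Qed.

(** A near-minimizer [t] is compared with [sbar]: near-minimality bounds T(t, sbar) above, hence
    T(sbar, t) below by antisymmetry, while the negative drift bounds T(sbar, t) above. Of the drift
    8 c0 h^2(s, t), the offset uses up only c0 / 2. *)
Lemma rho_estimator_le (S : set (forall i, X i -> R)) s sbar shat w (b : R) :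
  experiment mu Xv P -> S `<=` L0 mu -> L0 mu s -> S sbar ->
  hclosure mu (Eset mu (sample Xv w) S) shat ->
  (forall t, S t -> `|Zstat Xv P s sbar t w| <=
     c0 / 2 * (h2 mu s t + h2 mu s sbar) + b) ->
  h2 mu s shat <= 40 * h2 mu s sbar + 20 * b + 362.
Proof.
move=> expP SL Ls Sb [Lhat hat0] Zb.
have [c0l c0u] := @c0_itv R; have [c2l c2u] := @c2_itv R.
(* [shat] lies only in the closure of the near-minimizers, so one within distance 1 of it is used
   instead. *)
have [|t [St Et] ht] := @hset_attained shat (Eset mu (sample Xv w) S) 1.
  by rewrite hat0 lte_fin.
set x := sample Xv w in Et.
have Lb := SL _ Sb; have Lt := SL _ St.
set H := h2 mu s sbar.
have H0 : 0 <= H by exact: h2_ge0.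
have bnd u : S u -> Tstat mu x sbar u <=
    c2 * H + c0 / 2 * H + b - 15 / 2 * c0 * h2 mu s u.
  move=> Su; have := Tstat_le w expP Ls Lb (SL _ Su); have := Zb u Su.
  by rewrite -/x -/H; lra.
have Ub : (Upsilon mu x S sbar <= (c2 * H + c0 / 2 * H + b)%:E)%E.
  apply: ge_ereal_sup => _ [u Su <-]; rewrite lee_fin.
  have := bnd u Su; have : 0 <= c0 * h2 mu s u.
    by rewrite mulr_ge0 ?h2_ge0 //; lra.
  lra.
have : (((Tstat mu x t sbar)%:E) <= (c2 * H + c0 / 2 * H + b + kappa / 10)%:E)%E.
  apply: (@le_trans _ _ (Upsilon mu x S t)).
    by apply: ereal_sup_ubound; exists sbar.
  apply: le_trans Et _; rewrite EFinD leeD2r //.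
  by apply: le_trans Ub; apply: ereal_inf_lbound; exists sbar.
rewrite lee_fin (TstatC _ Lb Lt) /kappa => Tt.
have := bnd t St => Tt'.
(* 36 exceeds [kappa] / 10 = 35.7, and 5 exceeds 64 / 15, the inverse of 15 / 2 times the lower
   bound 1 / 32 of [c0]. *)
have xt : h2 mu s t <= 5 * (4 * H + 2 * b + 36).
  have c2H : c2 * H <= 7 / 4 * H by rewrite ler_wpM2r.
  have c0H : c0 * H <= 1 / 24 * H by rewrite ler_wpM2r.
  have x0 := h2_ge0 mu s t.
  have c0x : 1 / 32 * h2 mu s t <= c0 * h2 mu s t by rewrite ler_wpM2r.
  lra.
have hht : h2 mu t shat <= 1.
  by rewrite h2C -h_sqr expr_le1 ?sqrtr_ge0 // ltW.
have := h2_triangle Ls Lt Lhat; lra.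
Qed.

(** The infimum need not be attained: a point of [Sbar] within 1 of it is chosen, then a point of
    [S] within 1 of that. The bound 2 (eta + 1)^2 + 2 <= 4 eta^2 + 6 gives the constants. *)
Lemma approx_in_dense (Sbar S : set (forall i, X i -> R)) s :
  Sbar `<=` L0 mu -> dense_in mu S Sbar -> Sbar !=set0 -> L0 mu s ->
  exists eta sbar, [/\ hset mu s Sbar = eta%:E, S sbar &
    h2 mu s sbar <= 4 * eta ^+ 2 + 6].
Proof.
move=> SL [SS SD] [t0 St0] Ls.
have hs0 : (0 <= hset mu s Sbar)%E.
  by apply: le_ereal_inf_tmp => _ [u _ <-]; rewrite lee_fin sqrtr_ge0.
have hsy : (hset mu s Sbar < +oo)%E.
  apply: (@le_lt_trans _ _ (h mu s t0)%:E); last exact: ltry.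
  by apply: ereal_inf_lbound; exists t0.
have hfin : hset mu s Sbar \is a fin_num by rewrite ge0_fin_numE.
pose eta := fine (hset mu s Sbar).
have etaE : hset mu s Sbar = eta%:E by rewrite fineK.
have eta0 : 0 <= eta by exact: fine_ge0.
have [|u Su hu] := @hset_attained s Sbar (eta + 1).
  by rewrite etaE lte_fin ltrDl.
have [|v Sv hv] := @hset_attained u S 1.
  by have [_ ->] := SD _ Su; rewrite lte_fin.
exists eta, v; split=> //.
have h2u : h2 mu s u <= (eta + 1) ^+ 2.
  rewrite -h_sqr lerXn2r ?nnegrE ?sqrtr_ge0 ?(ltW hu) //; lra.
have h2v : h2 mu u v <= 1.
  by rewrite -h_sqr expr_le1 ?sqrtr_ge0 // ltW.
have := h2_triangle Ls (SL _ Su) (SL _ (SS _ Sv)).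
have := sqr_ge0 (eta - 1); lra.
Qed.

(** 602 = 40 * 6 + 362 combines the constants of [approx_in_dense] and [rho_estimator_le]. 320 = 20
    * 14 + 20 * 2, the last 2 bounding the mean of the control variable. *)
Definition risk_const : R := 602 + 320 / conc_rate.

Lemma risk_const_gt0 : 0 < risk_const.
Proof.
have : 0 < conc_rate^-1 :> R by rewrite invr_gt0 conc_rate_gt0.
by rewrite /risk_const; lra.
Qed.

Section risk.
Variables (Sbar S : set (forall i, X i -> R)) (V : nat).
Variable shat : (forall i, X i) -> (forall i, X i -> R).
Variable s : forall i, X i -> R.
Hypotheses (n0 : (0 < n)%N) (V0 : (0 < V)%N) (expP : experiment mu Xv P).
Hypotheses (SL : Sbar `<=` L0 mu) (S0 : Sbar !=set0).
Hypothesis vcS : vc_model Sbar V \/ diagonal_vc_model Sbar V.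
Hypotheses (cS : countable S) (SD : dense_in mu S Sbar).
Hypothesis rho : rho_estimator mu Xv S shat.
Hypothesis Ls : L0 mu s.

Let loss w := h2 mu s (shat (sample Xv w)).

Lemma measurable_loss : measurable_fun setT loss.
Proof.
rewrite (_ : loss = fun w => h mu s (shat (sample Xv w)) ^+ 2).
  by apply: measurable_funX; exact: rho.2.
by apply/funext => w; rewrite h_sqr.
Qed.

(** The level [b] is left free so that one statement serves both bounds: a fixed level on a likely
    event for the tail, the value of [M] itself for the mean. *)
Lemma loss_control : exists eta (M : Om -> \bar R),
  [/\ hset mu s Sbar = eta%:E, measurable_fun setT M, (forall w, 0 <= M w)%E,
    (\int[P s]_w M w <= 2%:E)%E &
    forall w b, (M w <= (expR b)%:E)%E -> loss w <=
      160 * eta ^+ 2 + 602 + 20 / conc_rate * (14 * vc_rate n V + b)].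
Proof.
have [eta [sbar [etaE Sb hb]]] := approx_in_dense SL SD S0 Ls.
have Lb : L0 mu sbar by exact/SL/SD.1.
have k0 := @conc_rate_gt0 R.
have [M [mM M0 iM MP]] := Zstat_concentration n0 expP SL vcS SD.1 cS
  (ex_intro _ _ Sb) Ls Lb.
exists eta, M; split=> // w b Mb.
have SL' : S `<=` L0 mu by exact: subset_trans SD.1 SL.
have Zb t : S t -> `|Zstat Xv P s sbar t w| <=
    c0 / 2 * (h2 mu s t + h2 mu s sbar) + (14 * vc_rate n V + b) / conc_rate.
  move=> St; have := le_trans (MP t w St) Mb; rewrite lee_fin ler_expR => h.
  by rewrite -lerBlDl ler_pdivlMr // mulrC; lra.
have := rho_estimator_le expP SL' Ls Sb (rho.1 w) Zb.
rewrite -/(loss w); lra.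
Qed.

Lemma loss_deviation (xi : R) : 0 < xi ->
  ((1 - expR (- xi))%:E <=
   P s [set w | ((risk_const^-1 * loss w)%:E <=
                 hset mu s Sbar ^+ 2 + (vc_rate n V)%:E + xi%:E)%E])%E.
Proof.
move=> xi0; have [eta [M [etaE mM M0 iM MP]]] := loss_control.
have k0 := @conc_rate_gt0 R.
have r1 := @vc_rate_ge1 R n V V0.
have q0 : 0 < conc_rate^-1 :> R by rewrite invr_gt0.
have rc0 := risk_const_gt0.
(* The extra 1 in the level compensates the bound 2 on the mean of [M], as 2 <= e. *)
rewrite etaE -EFin_expe; pose bad := [set w | ((expR (xi + 1))%:E <= M w)%E].
have mbad : measurable bad.
  by rewrite -[bad]setTI; exact: emeasurable_fun_c_infty.
have Pbad : (P s bad <= (expR (- xi))%:E)%E.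
  have ab : ((expR (xi + 1))%:E * P s bad <= 2%:E)%E.
    apply: le_trans iM.
    apply: (@le_trans _ _ (\int[P s]_(w in bad) (expR (xi + 1))%:E)%E).
      by rewrite (integral_cst (P s) mbad (expR (xi + 1))%:E).
    apply: (@le_trans _ _ (\int[P s]_(w in bad) M w)%E).
      by apply: ge0_le_integral => //; exact: measurable_funTS.
    apply: ge0_subset_integral => //.
  rewrite -(@lee_pmul2l _ (expR (xi + 1))%:E) ?lte_fin ?expR_gt0 //.
  apply: le_trans ab _; rewrite -EFinM lee_fin -expRD.
  have -> : xi + 1 - xi = 1 by ring.
  by have := expR_ge1Dx (1 : R); lra.
apply: (@le_trans _ _ (P s (~` bad))).
  rewrite probability_setC // EFinB leeB //.
apply: le_measure; rewrite ?inE //.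
- exact: measurableC.
- rewrite -[X in measurable X]setTI.
  apply: emeasurable_fun_infty_c => //.
  apply/measurable_EFinP; apply: measurable_funM => //; exact: measurable_loss.
move=> w /negP; rewrite -ltNge => /ltW/MP lw /=.
rewrite -!EFinD lee_fin mulrC ler_pdivrMr //.
apply: le_trans lw _.
have e0 := sqr_ge0 eta.
rewrite /risk_const; set q := conc_rate^-1 in q0 *.
have : 0 <= q * eta ^+ 2 by rewrite mulr_ge0 // ltW.
have : q <= q * vc_rate n V by rewrite ler_peMr // ltW.
have : 0 <= q * xi by rewrite mulr_ge0 // ltW.
lra.
Qed.

Lemma loss_expectation :
  ((risk_const^-1)%:E * 'E_(P s)[loss] <= hset mu s Sbar ^+ 2 + (vc_rate n V)%:E)%E.
Proof.
have [eta [M [etaE mM M0 iM MP]]] := loss_control.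
have k0 := @conc_rate_gt0 R.
have r1 := @vc_rate_ge1 R n V V0.
have q0 : 0 < conc_rate^-1 :> R by rewrite invr_gt0.
have rc0 := risk_const_gt0.
have e0 := sqr_ge0 eta.
set q := conc_rate^-1 in q0 MP *.
pose a := 160 * eta ^+ 2 + 602 + 20 * q * (14 * vc_rate n V).
have a0 : 0 <= a.
  have : 0 <= q * vc_rate n V by rewrite mulr_ge0 ?(ltW q0) // (le_trans ler01).
  rewrite /a; lra.
(* Where [M] has a finite value m, the level b = m is admissible because m <= exp m, and the loss
   becomes affine in [M]. *)
have lossM w : ((loss w)%:E <= a%:E + (20 * q)%:E * M w)%E.
  have := M0 w; have := MP w; case: (M w) => [m||] //; last first.
    move=> _ _; rewrite mulry gtr0_sg ?mul1e ?addey ?leey //.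
    by rewrite mulr_gt0.
  move=> Mw; rewrite lee_fin => m0.
  have /Mw : (m%:E <= (expR m)%:E)%E.
    by rewrite lee_fin; have := expR_ge1Dx m; lra.
  by rewrite -EFinM -EFinD lee_fin /a; lra.
have q20 : 0 <= 20 * q by lra.
have m2 : measurable_fun setT (fun w => (20 * q)%:E * M w)%E.
  exact: (measurable_funeM _ mM).
have p2 w : (0 <= (20 * q)%:E * M w)%E.
  by apply: mule_ge0; rewrite ?lee_fin.
have m3 : measurable_fun setT (fun w => a%:E + (20 * q)%:E * M w)%E.
  by apply: emeasurable_funD.
have Eloss : ('E_(P s)[loss] <= (a + 40 * q)%:E)%E.
  rewrite unlock.
  apply: (@le_trans _ _ (\int[P s]_w (a%:E + (20 * q)%:E * M w))%E).
    apply: ge0_le_integral => //.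
    - by move=> w _; rewrite lee_fin h2_ge0.
    - by apply/measurable_EFinP; exact: measurable_loss.
  rewrite ge0_integralD // (ge0_integralZl _ measurableT mM) //.
  have -> : (\int[P s]_w a%:E = a%:E)%E.
    transitivity (a%:E * P s setT)%E; first exact: integral_cst.
    by rewrite probability_setT mule1.
  apply: (@le_trans _ _ (a%:E + (20 * q)%:E * 2%:E)%E).
    by rewrite leeD2l // lee_wpmul2l // lee_fin.
  by rewrite -EFinM -EFinD lee_fin; lra.
apply: (@le_trans _ _ ((risk_const^-1)%:E * (a + 40 * q)%:E)%E).
  by rewrite lee_wpmul2l // lee_fin invr_ge0 ltW.
rewrite etaE -EFin_expe -EFinM -EFinD lee_fin mulrC ler_pdivrMr //.
rewrite /risk_const -/q /a.
have : 0 <= q * eta ^+ 2 by rewrite mulr_ge0 // ltW.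
have : q <= q * vc_rate n V by rewrite ler_peMr // ltW.
lra.
Qed.

End risk.
End rho_estimation.

Theorem theorem12 (R : realType) :
  exists C C' C'' : R, [/\ 0 < C, 0 < C' & 0 < C''] /\
  forall (n : nat) (d : 'I_n -> measure_display)
    (X : forall i : 'I_n, measurableType (d i))
    (mu : forall i : 'I_n, {measure set (X i) -> \bar R})
    (dO : measure_display) (Om : measurableType dO)
    (Xv : forall i : 'I_n, {mfun Om >-> X i})
    (P : (forall i, X i -> R) -> probability Om R)
    (Sbar : set (forall i, X i -> R)) (V : nat),
  (3 <= n)%N ->
  experiment mu Xv P ->
  model mu Sbar ->
  vc_model Sbar V \/ diagonal_vc_model Sbar V ->
  forall S : set (forall i, X i -> R),
  countable S -> identifiable mu S -> dense_in mu S Sbar ->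
  ((uniform_dim mu Xv P Sbar <= c2%:E * Dbar mu Xv P S)%E /\
   (c2%:E * Dbar mu Xv P S <= (C * vc_rate n V)%:E)%E) /\
  forall shat : (forall i, X i) -> (forall i, X i -> R),
  rho_estimator mu Xv S shat ->
  forall s : forall i, X i -> R, L0 mu s ->
  (forall xi : R, 0 < xi ->
     ((1 - expR (- xi))%:E <=
      P s [set w | ((C' * h2 mu s (shat (sample Xv w)))%:E <=
                    hset mu s Sbar ^+ 2 + (vc_rate n V)%:E + xi%:E)%E])%E) /\
  (C''%:E * 'E_(P s)[fun w => h2 mu s (shat (sample Xv w))] <=
   hset mu s Sbar ^+ 2 + (vc_rate n V)%:E)%E.
Proof.
have k0 := @conc_rate_gt0 R.
have [c0l c0u] := @c0_itv R; have [c2l c2u] := @c2_itv R.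
have c0p : 0 < c0 :> R by lra.
have rc0 : 0 < risk_const^-1 :> R.
  by rewrite invr_gt0 risk_const_gt0.
have c2p : 0 < c2 :> R by lra.
exists (c2 * dim_const), risk_const^-1, risk_const^-1; split.
  by split=> //; rewrite mulr_gt0 // /dim_const addr_gt0 // divr_gt0 // mulr_gt0.
move=> n d X mu dO Om Xv P Sbar V n3 expP [SL S0 _] vcS S cS idS SD.
have n0 : (0 < n)%N by exact: leq_trans n3.
have [t0 St0] := S0.
have V0 : (0 < V)%N.
  have [Xi [G [iota [vcG GS]]]] := vc_model_pullback vcS.
  by have [u Gu _] := GS _ St0; exact: vc_subgraph_index_gt0 vcG Gu.
(* An empty [S] would be at distance +oo from [t0], against density. *)
have Sne : S !=set0.
  have [|u Su _] := @hset_attained R n d X mu t0 S 1; last by exists u.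
  by have [_ ->] := SD.2 _ St0; rewrite lte_fin.
split.
  split; first exact: uniform_dim_le.
  rewrite -mulrA EFinM lee_wpmul2l ?lee_fin ?(ltW c2p) //.
  exact: Dbar_le SD.1 cS Sne.
move=> shat rho s Ls; split.
  by move=> xi xi0; exact: (loss_deviation n0 V0 expP SL S0 vcS cS SD rho Ls xi0).
exact: (loss_expectation n0 V0 expP SL S0 vcS cS SD rho Ls).
Qed.
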